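(* Let $a>0$, $B>0$, and let $u$ be a non-trivial u.l.m. point process on $\mathbb{R}$ that is $\mathbb{R}$-translation-invariant in the correlation sense. If a point process $u'$ supported on $a\mathbb{Z}$ mimics $u$ at the bandwidth $[-B,B]$, then $B\le\frac1a$.
   Context: A configuration in $\mathbb{R}$ is a locally finite countable (possibly finite or empty) family $u=(u_j)_j$ of real numbers, repetitions allowed and counted with multiplicity (the labelling is irrelevant). For $V\subset\mathbb{R}$ put $\#_V(u)=\#\{j: u_j\in V\}$. A point process on $\mathbb{R}$ is a random configuration, measurable with respect to the $\sigma$-algebra generated by the sets $\{u:\#_V(u)=m\}$ with $V$ a bounded Borel set and $m\ge 0$ an integer. It is supported on $a\mathbb{Z}=\{aj: j\in\mathbb{Z}\}$ if all its points lie in $a\mathbb{Z}$. It is trivial if $\#_V(u)=0$ almost surely for all Borel sets $V$, and non-trivial otherwise. A point process is u.l.m. (has uniform local moments) if for each $n\ge1$ there is $C_n<\infty$ with $\mathbb{E}[(\#_{[L,L+1]}(u))^n]\le C_n$ for all $L\in\mathbb{R}$. For a u.l.m. point process $u$ and $n\ge 1$, the $n$-level correlation measure $\rho_n$ is the unique Borel measure on $\mathbb{R}^n$ with $\mathbb{E}\sum_{j_1,\dots,j_n\ \text{distinct}}\phi(u_{j_1},\dots,u_{j_n})=\int_{\mathbb{R}^n}\phi\,d\rho_n$ for all $\phi\in C_c(\mathbb{R}^n)$. The process is $\mathbb{R}$-translation-invariant in the correlation sense if for every $n\ge1$ and every $t\in\mathbb{R}$ the measure $\rho_n$ is invariant under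 $(x_1,\dots,x_n)\mapsto(x_1+t,\dots,x_n+t)$. Fourier transform: $\hat\eta(\xi)=\int_{\mathbb{R}^n}\eta(x)e^{-2\pi i x\cdot\xi}\,dx$. $\mathcal{S}(\mathbb{R}^n)$ is the Schwartz class. For u.l.m. point processes $u,v$ on $\mathbb{R}$ and $B>0$, $v$ mimics $u$ at the bandwidth $[-B,B]$ if for each $n\ge1$ and all $\eta\in\mathcal{S}(\mathbb{R}^n)$ with $\hat\eta$ supported in $[-B,B]^n$, $\mathbb{E}\sum_{j_1,\dots,j_n\ \text{distinct}}\eta(u_{j_1},\dots,u_{j_n})=\mathbb{E}\sum_{j_1,\dots,j_n\ \text{distinct}}\eta(v_{j_1},\dots,v_{j_n})$. In particular a mimicking process is always u.l.m. *)

(* Defs.v *)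
From HB Require Import structures.
From mathcomp Require Import all_boot all_order all_algebra.
From mathcomp Require Import complex.
From mathcomp Require Import all_classical all_reals all_analysis.
From mathcomp Require Import measurable_realfun.

Set Implicit Arguments.
Unset Strict Implicit.
Unset Printing Implicit Defensive.

Import Order.TTheory GRing.Theory Num.Theory.
Import numFieldNormedType.Exports.

Local Open Scope classical_set_scope.
Local Open Scope complex_scope.
Local Open Scope ring_scope.

(* A countable family of reals, repetitions allowed: the values [point j] for
   the labels [j] in [labels]. *)
Record configuration (R : realType) := Configuration {
  labels : set nat;
  point : nat -> R;
  locally_finite : forall r : R,
    finite_set [set j | labels j /\ `|point j| <= r] }.

Lemma empty_configuration_subproof (R : realType) (r : R) :
  finite_set [set j : nat | (set0 : set nat) j /\ `|0 : R| <= r].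
Proof. by apply: sub_finite_set (finite_set0 nat) => j []. Qed.

Definition empty_configuration (R : realType) : configuration R :=
  Configuration (@empty_configuration_subproof R).

HB.instance Definition _ (R : realType) := gen_eqMixin (configuration R).
HB.instance Definition _ (R : realType) := gen_choiceMixin (configuration R).
HB.instance Definition _ (R : realType) :=
  isPointed.Build (configuration R) (@empty_configuration R).

Definition number (R : realType) (V : set R) (c : configuration R) : \bar R :=
  counting (labels c `&` point c @^-1` V).

Definition number_events (R : realType) : set (set (configuration R)) :=
  [set S | exists (V : set R) (m : nat),
     [/\ measurable V, bounded_set V & S = [set c | number V c = m%:R%:E]]].

(* The sigma-algebra does not see the labelling: a point process is a random
   variable with values in this space. *)
Definition configuration_space (R : realType) :=
  g_sigma_algebraType (@number_events R).

(* R^n with its Borel sigma-algebra. *)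
Definition Rn (R : realType) (n : nat) := g_sigma_algebraType (@open 'rV[R]_n).

Lemma measurable_coord (R : realType) n (i : 'I_n) :
  measurable_fun [set: Rn R n] (fun x : Rn R n => (x : 'rV[R]_n) 0 i).
Proof.
apply: (measurability _ (RGenOInfty.measurableE R)).
move=> _ [_ [a ->] <-]; rewrite setTI; apply: sub_sigma_algebra.
by apply: open_comp => [x _|]; [exact: coord_continuous|exact: interval_open].
Qed.

Lemma measurable_fun_Rn d (T : measurableType d) (R : realType) n
    (f : T -> Rn R n) :
  (forall i, measurable_fun [set: T] (fun t => (f t : 'rV[R]_n) 0 i)) ->
  measurable_fun [set: T] f.
Proof.
move=> mf; apply: (@measurability _ _ T (Rn R n) _ _ (@open 'rV[R]_n)) => //.
move=> _ [U oU <-].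
pose box (p : 'rV[rat]_n * nat) := [set x : 'rV[R]_n |
  forall i, `|ratr (p.1 0 i) - x 0 i| < p.2.+1%:R^-1].
pose F p := [set t | box p `<=` U /\ box p (f t)].
have -> : f @^-1` U = \bigcup_p F p.
  apply/seteqP; split=> [t Uft|t [p _ [pU]]]; last exact: pU.
  have /nbhs_ballP[e /= e0 xeU] : nbhs (f t : 'rV[R]_n) U.
    exact: open_nbhs_nbhs.
  have [k ke] : exists k : nat, k.+1%:R^-1 < e / 2.
    have /ltr_add_invr[k] : (0 : R) < e / 2 by rewrite divr_gt0.
    by rewrite add0r; exists k.
  have k0 : (0 : R) < k.+1%:R^-1 by rewrite invr_gt0 ltr0n.
  have [q qP] : {q : 'I_n -> rat &
      forall i, `|ratr (q i) - (f t : 'rV[R]_n) 0 i| < k.+1%:R^-1}.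
    apply: (@choice _ _ (fun i (r : rat) =>
      `|ratr r - (f t : 'rV[R]_n) 0 i| < k.+1%:R^-1)) => i.
    have /rat_in_itvoo[r] : (f t : 'rV[R]_n) 0 i - k.+1%:R^-1
                          < (f t : 'rV[R]_n) 0 i + k.+1%:R^-1.
      by rewrite ltrBlDr -addrA ltrDl addr_gt0.
    rewrite in_itv /= => /andP[r1 r2]; exists r.
    by rewrite ltr_distl r1 r2.
  exists (\row_i q i, k) => //; split; last by move=> i /=; rewrite mxE.
  move=> y /= yb; apply: xeU; split => // i j; rewrite (ord1 i).
  rewrite /ball /=; have := yb j; rewrite /= mxE => yj.
  have := ltrD (qP j) yj; rewrite -(distrC _ (ratr (q j))).
  move=> h; have := le_lt_trans (ler_normD _ _) h.
  rewrite addrA subrK => /lt_trans; apply.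
  by rewrite [ltRHS](splitr e) ltrD.
rewrite setTI; apply: countable_bigcupT_measurable => [|p].
  exact: countableP.
have [pU|npU] := pselect (box p `<=` U); last first.
  by rewrite (_ : F p = set0)//; apply/seteqP; split=> t // [].
rewrite (_ : F p = \bigcap_(i in [set: 'I_n])
    [set t | `|ratr (p.1 0 i) - (f t : 'rV[R]_n) 0 i| < p.2.+1%:R^-1]).
  apply: fin_bigcap_measurable => // i _.
  have /(mf i measurableT) := open_measurable
    (@ball_open _ R (ratr (p.1 0 i)) p.2.+1%:R^-1).
  by rewrite setTI.
apply/seteqP; split => [t [_ bt] i _|t bt]; first exact: bt.
by split=> // i; exact: bt.
Qed.

Definition snoc (R : realType) n (p : Rn R n * measurableTypeR R) : Rn R n.+1 :=
  \row_(i < n.+1) (if unlift ord_max i is Some j then (p.1 : 'rV[R]_n) 0 j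
                   else p.2).

Lemma measurable_snoc (R : realType) n :
  measurable_fun [set: Rn R n * measurableTypeR R] (@snoc R n).
Proof.
apply: measurable_fun_Rn => i; rewrite /snoc.
under eq_fun do rewrite mxE.
case: (unlift _ _) => [j|]; last exact: measurable_snd.
apply: (@measurableT_comp _ _ _ _ _ _ (fun x : Rn R n => (x : 'rV[R]_n) 0 j)).
  exact: measurable_coord.
exact: measurable_fst.
Qed.

(* Lebesgue measure on R^n as the iterated product measure, transported along
   the identification [snoc] of R^n * R with R^(n + 1). *)
Section lebesgue_step.
Context (R : realType) (n : nat) (mu : {measure set (Rn R n) -> \bar R}).

Definition lebesgue_step : set (Rn R n.+1) -> \bar R :=
  pushforward (mu \x @lebesgue_measure R)%E (@snoc R n).

HB.instance Definition _ := Measure.copy lebesgue_step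
  (measure_function_pushforward__canonical__measure_function_Measure
    (mu \x @lebesgue_measure R)%E (@measurable_snoc R n)).

End lebesgue_step.

Fixpoint lebesgue_Rn (R : realType) (n : nat) :
    {measure set (Rn R n) -> \bar R} :=
  match n with
  | 0 => dirac ((0 : 'rV[R]_0) : Rn R 0)
  | m.+1 => lebesgue_step (lebesgue_Rn R m)
  end.

Definition cintegral d (T : measurableType d) (R : realType)
    (mu : {measure set T -> \bar R}) (f : T -> R[i]) : R[i] :=
  Rintegral mu setT (fun x => complex.Re (f x))
  +i* Rintegral mu setT (fun x => complex.Im (f x)).

Definition cis (R : realType) (t : R) : R[i] := cos t +i* sin t.

Definition dot (R : realType) n (x y : 'rV[R]_n) : R :=
  \sum_(i < n) x 0 i * y 0 i.

Definition fourier (R : realType) n (eta : 'rV[R]_n -> R[i]) (xi : 'rV[R]_n) :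
    R[i] :=
  cintegral (lebesgue_Rn R n)
    (fun x : Rn R n => eta x * cis (- (2 * pi * dot x xi))).

(* The iterated partial derivative of [f] along the list of coordinates [s],
   the last one in [s] first. *)
Definition partial (R : realType) n (s : seq 'I_n) (f : 'rV[R]_n -> R) :
    'rV[R]_n -> R :=
  foldr (fun i g => 'D_(delta_mx 0 i) g) f s.

Definition smooth (R : realType) n (f : 'rV[R]_n -> R) : Prop :=
  forall s : seq 'I_n, continuous (partial s f) /\
    forall (i : 'I_n) x, derivable (partial s f) x (delta_mx 0 i).

Definition rapidly_decreasing (R : realType) n (f : 'rV[R]_n -> R) : Prop :=
  forall (s : seq 'I_n) (alpha : 'I_n -> nat), exists C : R,
    forall x : 'rV[R]_n,
      `|(\prod_(i < n) x 0 i ^+ alpha i) * partial s f x| <= C.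

(* The Schwartz class; [R[i]] is not a normed space over [R] in the library, so
   the derivatives are those of the real and imaginary parts. *)
Definition schwartz (R : realType) n (eta : 'rV[R]_n -> R[i]) : Prop :=
  [/\ smooth (fun x => complex.Re (eta x)),
      smooth (fun x => complex.Im (eta x)),
      rapidly_decreasing (fun x => complex.Re (eta x)) &
      rapidly_decreasing (fun x => complex.Im (eta x))].

Definition distinct_labels (R : realType) n (c : configuration R) :
    set (n.-tuple nat) :=
  [set j : n.-tuple nat | uniq j /\ forall i, labels c (tnth j i)].

Definition points (R : realType) n (c : configuration R) (j : n.-tuple nat) :
    'rV[R]_n := \row_(i < n) point c (tnth j i).

(* The absolutely convergent sum of [phi (u_{j_1}, ..., u_{j_n})] over distinct
   labels, as the difference of the sums of the positive and negative parts. *)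
Definition linear_statistic (R : realType) n (phi : 'rV[R]_n -> R)
    (c : configuration R) : \bar R :=
  (\esum_(j in distinct_labels c) (Num.max (phi (points c j)) 0)%:E
   - \esum_(j in distinct_labels c) (Num.max (- phi (points c j)) 0)%:E)%E.

Section point_process.
Context d (T : measurableType d) (R : realType) (P : probability T R).
Variable u : {RV P >-> configuration_space R}.

(* Almost surely, all points lie in [a Z]. *)
Definition supported_on_lattice (a : R) : Prop :=
  {ae P, forall w, forall j, labels (u w) j ->
     exists k : int, point (u w) j = a * k%:~R}.

Definition trivial_process : Prop :=
  forall V : set R, measurable V -> {ae P, forall w, number V (u w) = 0%E}.

(* Uniform local moments. *)
Definition ulm : Prop :=
  forall n : nat, (0 < n)%N -> exists C : R, forall L : R,
    (\int[P]_w (number `[L, (L + 1)%R]%classic (u w) ^+ n) <= C%:E)%E.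

Definition mean_statistic n (phi : 'rV[R]_n -> R) : \bar R :=
  (\int[P]_w linear_statistic phi (u w))%E.

Definition mean_cstatistic n (eta : 'rV[R]_n -> R[i]) : R[i] :=
  fine (mean_statistic (fun x => complex.Re (eta x)))
  +i* fine (mean_statistic (fun x => complex.Im (eta x))).

Definition is_correlation_measure n (rho : {measure set (Rn R n) -> \bar R}) :
    Prop :=
  forall phi : 'rV[R]_n -> R, continuous phi ->
    compact (closure [set x | phi x != 0]) ->
    mean_statistic phi = (\int[rho]_x (phi x)%:E)%E.

(* The correlation measure of each order exists and is unique when [u] is
   u.l.m. *)
Definition correlation_translation_invariant : Prop :=
  forall n : nat, (0 < n)%N ->
    exists rho : {measure set (Rn R n) -> \bar R},
      is_correlation_measure rho /\
      forall (t : R) (A : set (Rn R n)), measurable A ->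
        rho [set x : 'rV[R]_n | A (x + const_mx t)] = rho A.

End point_process.

(* [v] mimics [u] at the bandwidth [[-B, B]]. *)
Definition mimics d (T : measurableType d) d' (T' : measurableType d')
    (R : realType) (P : probability T R) (Q : probability T' R)
    (v : {RV Q >-> configuration_space R})
    (u : {RV P >-> configuration_space R}) (B : R) : Prop :=
  [/\ ulm u, ulm v &
      forall (n : nat) (eta : 'rV[R]_n -> R[i]), (0 < n)%N -> schwartz eta ->
        (forall xi : 'rV[R]_n, fourier eta xi != 0 ->
           forall i, `|xi 0 i| <= B) ->
        mean_cstatistic u eta = mean_cstatistic v eta].

(* Main.v *)
(** Suppose [B > 1/a].  It is enough to find a nonnegative Schwartz function
    [phi], not identically zero, whose Fourier transform is supported in
    [[-B, B]] and which vanishes on [a Z].  Mimicry with [n = 1] gives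
    [E sum_j phi (u_j) = E sum_j phi (u'_j) = 0] (the left side being finite by
    uniform local moments), so [u] almost surely has no point in an interval
    where [phi > 0]; by translation invariance it has none in any translate of
    a smaller interval, hence no point at all.

    We take [phi x = (h x)^2 (1 - cos (2 pi x / a))], where
    [h x = \int_(-b)^b G y cos (x y) dy] with the bump
    [G y = exp (- 1 / (b^2 - y^2))] and [b] small.  Fourier inversion is
    avoided: for [|xi| > b] the function [h x * cos (xi x)] is the derivative
    of a rapidly decreasing function, namely of a combination of transforms of
    [G y / (y^2 - xi^2)], so its integral is zero.  One application of Fubini
    then handles [h^2]. *)

Require Import Defs.
From mathcomp Require Import all_boot all_order all_algebra.
From mathcomp Require Import complex ring lra finmap.
From mathcomp Require Import all_classical all_reals all_analysis.
From mathcomp Require Import measurable_realfun.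

Set Implicit Arguments.
Unset Strict Implicit.
Unset Printing Implicit Defensive.

Import Order.TTheory GRing.Theory Num.Theory.
Import numFieldNormedType.Exports.

Local Open Scope classical_set_scope.
Local Open Scope ring_scope.

(** * Smooth functions supported in [[-b, b]] *)

Section real_derivatives.
Context {R : realType}.
Implicit Types (f g : R -> R) (x a b : R).

Lemma is_derive1D f g x a b : is_derive x 1 f a -> is_derive x 1 g b ->
  is_derive x 1 (fun y => f y + g y) (a + b).
Proof. exact: is_deriveD. Qed.

Lemma is_derive1M f g x a b : is_derive x 1 f a -> is_derive x 1 g b ->
  is_derive x 1 (fun y => f y * g y) (a * g x + f x * b).
Proof.
move=> fa gb; have fg := @is_deriveM _ _ f g x 1 a b fa gb.
by apply: (is_derive_eq fg); rewrite /GRing.scale/= addrC (mulrC (g x)).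
Qed.

Lemma is_derive1Z f x a c : is_derive x 1 f a ->
  is_derive x 1 (fun y => c * f y) (c * a).
Proof. exact: is_deriveZ. Qed.

Lemma is_derive1V f x a : f x != 0 -> is_derive x 1 f a ->
  is_derive x 1 (fun y => (f y)^-1) (- a / f x ^+ 2).
Proof.
move=> fx0 fa; have fV := @is_deriveV _ f x a 1 fx0 fa.
by apply: (is_derive_eq fV); rewrite /GRing.scale/= !mulNr mulrC.
Qed.

Lemma is_derive1_sqrB c x : is_derive x 1 (fun y => y ^+ 2 - c) (2 * x).
Proof.
have h := @is_derive1D _ (fun=> - c) _ _ _
  (is_derive1M (is_derive_id x 1) (is_derive_id x 1)) (is_derive_cst (- c) x 1).
by apply: (is_derive_eq h); rewrite addr0 mul1r mulr1 -mulr2n mulr_natl.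
Qed.

Lemma is_derive1_sqrBV c x : x ^+ 2 - c != 0 ->
  is_derive x 1 (fun y => (y ^+ 2 - c)^-1) (- (2 * x) / (x ^+ 2 - c) ^+ 2).
Proof.
move=> xc; exact: (@is_derive1V (fun y => y ^+ 2 - c) x _ xc (is_derive1_sqrB c x)).
Qed.

Lemma is_derive1_cosM x y : is_derive x 1 (fun z => cos (y * z)) (- y * sin (y * x)).
Proof.
have h := @is_derive1_comp R cos (fun z => y * z) x _ _ (is_derive_cos _)
  (is_derive1Z y (is_derive_id x 1)).
by apply: (is_derive_eq h); rewrite mulr1 !mulNr mulrC.
Qed.

Lemma is_derive1_sinM x y : is_derive x 1 (fun z => sin (y * z)) (y * cos (y * x)).
Proof.
have h := @is_derive1_comp R sin (fun z => y * z) x _ _ (is_derive_sin _)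
  (is_derive1Z y (is_derive_id x 1)).
by apply: (is_derive_eq h); rewrite mulr1 mulrC.
Qed.

Lemma is_derive1_continuous f x a : is_derive x 1 f a -> {for x, continuous f}.
Proof. by move=> [+ _]; move=> /derivable1_diffP/differentiable_continuous. Qed.

End real_derivatives.

Section test_functions.
Context {R : realType}.
Implicit Types (b y xi : R) (G : R -> R).

Definition bump b y : R :=
  if `|y| < b then expR (- (b ^+ 2 - y ^+ 2)^-1) else 0.

(* Every member is smooth, vanishes outside [(-b, b)], and the class is closed
   under differentiation: allowing [b = |xi|] in [test_div] produces the
   derivatives of the bump itself. *)
Inductive test_fun b : (R -> R) -> Prop :=
| test_bump : test_fun b (bump b)
| test_mulX G : test_fun b G -> test_fun b (fun y => y * G y)
| test_div xi G : b <= `|xi| -> test_fun b G ->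
    test_fun b (fun y => G y / (y ^+ 2 - xi ^+ 2))
| test_add G H : test_fun b G -> test_fun b H -> test_fun b (fun y => G y + H y)
| test_scale c G : test_fun b G -> test_fun b (fun y => c * G y).

Lemma subr_sqr_gt0 b y : `|y| < b -> 0 < b ^+ 2 - y ^+ 2.
Proof.
move=> yb; rewrite subr_gt0 -(real_normK (num_real y)) ltrXn2r//.
Qed.

Lemma ler_sqr_dist b y xi : `|y| < b -> b <= `|xi| ->
  b ^+ 2 - y ^+ 2 <= `|y ^+ 2 - xi ^+ 2|.
Proof.
move=> yb bxi; rewrite distrC; apply: le_trans (ler_norm _).
rewrite lerD2r -(real_normK (num_real xi)) lerXn2r ?nnegrE//.
by rewrite (le_trans _ (ltW yb)).
Qed.

(** A single term of the exponential series at [s^-1] bounds [expR s^-1] from below; take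
    inverses. *)
Lemma expRN_inv_le (s : R) k : 0 < s -> expR (- s^-1) <= k.+1`!%:R * s ^+ k.+1.
Proof.
move=> s0; rewrite expRN -[leRHS]invrK lef_pV2 ?posrE ?expR_gt0//; last first.
  by rewrite invr_gt0 mulr_gt0 ?ltr0n ?fact_gt0 ?exprn_gt0.
have := @expR_ge1Dxn R s^-1 k; rewrite invr_ge0 (ltW s0) => /(_ isT).
by apply: le_trans; rewrite invfM exprVn mulrC lerDr.
Qed.

Lemma test_outside b G : test_fun b G -> forall y, b <= `|y| -> G y = 0.
Proof.
elim=> [|{}G _ ih|xi {}G _ _ ih|{}G H _ ihG _ ihH|c {}G _ ih] y yb.
- by rewrite /bump ltNge yb.
- by rewrite ih ?mulr0.
- by rewrite ih ?mul0r.
- by rewrite ihG ?ihH ?addr0.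
- by rewrite ih ?mulr0.
Qed.

(** Flatness of every order at the endpoints, which is what survives division: by [ler_sqr_dist] a
    factor [y ^+ 2 - xi ^+ 2] costs at most one power of [b ^+ 2 - y ^+ 2], so the induction
    hypothesis is used at [k.+1]. *)
Lemma test_flat b G : test_fun b G -> forall k, exists C : R,
  forall y, `|y| < b -> `|G y| <= C * (b ^+ 2 - y ^+ 2) ^+ k.
Proof.
elim=> [k|{}G _ ih k|xi {}G bxi _ ih k|{}G H _ ihG _ ihH k|c {}G _ ih k].
- exists (k.+1`!%:R * b ^+ 2) => y yb; rewrite /bump yb ger0_norm ?expR_ge0//.
  have s0 := subr_sqr_gt0 yb.
  rewrite (le_trans (expRN_inv_le k s0))// exprS mulrA ler_wpM2r//.
    by rewrite exprn_ge0// ltW.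
  by rewrite ler_wpM2l// gerBl sqr_ge0.
- have [C GC] := ih k; exists (b * C) => y yb.
  by rewrite normrM -mulrA ler_pM// ?GC// ltW.
- have [C GC] := ih k.+1; exists C => y yb.
  have s0 := subr_sqr_gt0 yb; have sxi := ler_sqr_dist yb bxi.
  have d0 := lt_le_trans s0 sxi.
  rewrite normrM normfV ler_pdivrMr// (le_trans (GC _ yb))// exprSr mulrA.
  rewrite ler_wpM2l//; have := GC _ yb.
  (* The sign of [C] is not known beforehand; a negative one would contradict [0 <= |G y|]. *)
  have [C0|C0 h] := leP 0 C; first by rewrite mulr_ge0// exprn_ge0// ltW.
  have := le_trans (normr_ge0 _) h.
  by rewrite nmulr_rge0// leNgt exprn_gt0.
- have [C GC] := ihG k; have [D HD] := ihH k; exists (C + D) => y yb.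
  by rewrite (le_trans (ler_normD _ _))// mulrDl lerD ?GC ?HD.
- have [C GC] := ih k; exists (`|c| * C) => y yb.
  by rewrite normrM -mulrA ler_wpM2l// GC.
Qed.

Lemma subr_sqr_neq0 b y xi : `|y| < b -> b <= `|xi| -> y ^+ 2 - xi ^+ 2 != 0.
Proof.
move=> yb bxi; rewrite -normr_gt0.
exact: lt_le_trans (subr_sqr_gt0 yb) (ler_sqr_dist yb bxi).
Qed.

(** Derivatives inside the open interval suffice for integration by parts over [[-b, b]]. *)
Lemma test_derive b G : 0 < b -> test_fun b G ->
  exists2 G', test_fun b G' & forall y, `|y| < b -> is_derive y 1 G (G' y).
Proof.
move=> b0; elim=> [|{}G tG [G' tG' dG]|xi {}G bxi tG [G' tG' dG]
   |{}G H _ [G' tG' dG] _ [H' tH' dH]|c {}G _ [G' tG' dG]].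
- have bb : b <= `|b| by exact: ler_norm.
  exists (fun y => - 2 * (y * (bump b y / (y ^+ 2 - b ^+ 2) / (y ^+ 2 - b ^+ 2)))).
    apply/test_scale/test_mulX.
    apply: (@test_div b b (fun y => bump b y / (y ^+ 2 - b ^+ 2)) bb).
    exact: (test_div bb (test_bump b)).
  move=> y yb.
  apply: (@near_eq_is_derive _ _ _ (fun y => expR ((y ^+ 2 - b ^+ 2)^-1))).
    have : y \in `]-b, b[ by rewrite in_itv/= -ltr_norml.
    move=> /near_in_itvoo yy; near=> z.
    have : z \in `]-b, b[ by near: z.
    rewrite in_itv/= -ltr_norml => zb.
    by rewrite /bump zb -invrN opprB.
  have h := @is_derive1_comp _ expR (fun y => (y ^+ 2 - b ^+ 2)^-1) y _ _
    (is_derive_expR _)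
    (is_derive1_sqrBV (subr_sqr_neq0 yb bb)).
  apply: (is_derive_eq h); rewrite /bump yb -invrN opprB; set s := y ^+ 2 - b ^+ 2.
  have s0 : s != 0 by exact: subr_sqr_neq0 yb bb.
  by field.
- exists (fun y => G y + y * G' y); first exact/test_add/test_mulX.
  move=> y yb; have h := is_derive1M (is_derive_id y 1) (dG y yb).
  by apply: (is_derive_eq h); rewrite mul1r.
- exists (fun y => G' y / (y ^+ 2 - xi ^+ 2)
      + - 2 * (y * (G y / (y ^+ 2 - xi ^+ 2) / (y ^+ 2 - xi ^+ 2)))).
    apply: test_add; first exact: test_div.
    apply/test_scale/test_mulX.
    apply: (@test_div b xi (fun y => G y / (y ^+ 2 - xi ^+ 2)) bxi).
    exact: test_div.
  move=> y yb; have h := is_derive1M (dG y yb)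
    (is_derive1_sqrBV (subr_sqr_neq0 yb bxi)).
  apply: (is_derive_eq h).
  have s0 := subr_sqr_neq0 yb bxi.
  by field.
- exists (fun y => G' y + H' y); first exact: test_add.
  by move=> y yb; apply: is_derive1D; [exact: dG|exact: dH].
- exists (fun y => c * G' y); first exact: test_scale.
  by move=> y yb; apply: is_derive1Z; exact: dG.
Unshelve. all: by end_near. Qed.

Lemma test_continuous b G : 0 < b -> test_fun b G -> continuous G.
Proof.
move=> b0 tG y; have [yb|yb] := ltP `|y| b.
  have [G' _ dG] := test_derive b0 tG.
  exact: is_derive1_continuous (dG y yb).
have [C GC] := test_flat tG 1.
(* This is [2 |C| max (b^2 - z^2) 0]: a continuous majorant that vanishes from the endpoints
   outwards, used for a squeeze at [y]. *)
pose M (z : R) := `|C| * (`|b ^+ 2 - z ^+ 2| + (b ^+ 2 - z ^+ 2)).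
have GM z : `|G z| <= M z.
  have [zb|zb] := ltP `|z| b; last first.
    rewrite (test_outside tG zb) normr0 mulr_ge0// -lerBlDr sub0r.
    by rewrite -normrN ler_norm.
  have s0 := subr_sqr_gt0 zb.
  have h := GC z zb; rewrite expr1 in h.
  rewrite (le_trans h)// /M (ger0_norm (ltW s0)).
  rewrite (@le_trans _ _ (`|C| * (b ^+ 2 - z ^+ 2)))//.
    by rewrite ler_wpM2r ?(ltW s0)// ler_norm.
  by rewrite ler_wpM2l// lerDl ltW.
have cs : {for y, continuous (fun z : R => b ^+ 2 - z ^+ 2)}.
  by apply: cvgB; [exact: cvg_cst|exact: exprn_continuous].
have cM : M z @[z --> y] --> (0 : R).
  have -> : (0 : R) = M y.
    have yb2 : b ^+ 2 - y ^+ 2 <= 0.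
      rewrite subr_le0 -(real_normK (num_real y)) lerXn2r ?nnegrE//.
      exact: ltW.
    by rewrite /M (ler0_norm yb2) addNr mulr0.
  apply: cvgM; first exact: cvg_cst.
  by apply: cvgD => //; exact: cvg_norm.
rewrite /continuous_at (test_outside tG yb).
apply/norm_cvg0P; apply: (squeeze_cvgr _ (cvg_cst 0) cM).
by near=> z; rewrite normr_ge0 GM.
Unshelve. all: by end_near. Qed.

End test_functions.

(** * Their cosine and sine transforms *)

Section transforms.
Context {R : realType}.
Variable b : R.
Hypothesis b_gt0 : 0 < b.
Implicit Types (x y xi : R) (G H : R -> R).
Local Notation mu := (@lebesgue_measure R).

(** Real and imaginary parts of the integral of [G y * exp (i x y)]. The frequency is angular; the
    factor [2 * pi] of [fourier] enters only in [fourier_band_limited]. *)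
Definition cosT G x : R := \int[mu]_(y in `[- b, b]) (G y * cos (y * x)).
Definition sinT G x : R := \int[mu]_(y in `[- b, b]) (G y * sin (y * x)).

Lemma continuous_cosM x : continuous (fun y => cos (y * x)).
Proof.
move=> y; under eq_fun do rewrite mulrC.
exact: is_derive1_continuous (is_derive1_cosM y x).
Qed.

Lemma continuous_sinM x : continuous (fun y => sin (y * x)).
Proof.
move=> y; under eq_fun do rewrite mulrC.
exact: is_derive1_continuous (is_derive1_sinM y x).
Qed.

Lemma integrable_segment (f : R -> R) : continuous f ->
  mu.-integrable `[- b, b] (EFin \o f).
Proof.
move=> cf; apply: continuous_compact_integrable; first exact: segment_compact.
exact: continuous_subspaceT.
Qed.

Lemma integrable_cosT G x : test_fun b G ->
  mu.-integrable `[- b, b] (fun y => (G y * cos (y * x))%:E).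
Proof.
move=> tG; apply: (@integrable_segment (fun y => G y * cos (y * x))) => y.
by apply: continuousM; [exact: (test_continuous b_gt0 tG)|exact: continuous_cosM].
Qed.

Lemma integrable_sinT G x : test_fun b G ->
  mu.-integrable `[- b, b] (fun y => (G y * sin (y * x))%:E).
Proof.
move=> tG; apply: (@integrable_segment (fun y => G y * sin (y * x))) => y.
by apply: continuousM; [exact: (test_continuous b_gt0 tG)|exact: continuous_sinM].
Qed.

Lemma is_derive_under (f df : R -> R -> R) (g : R -> R) x :
  (forall y z : R, is_derive z 1 (f ^~ y) (df z y)) ->
  (forall z, continuous (f z)) -> continuous g ->
  (forall z y, `|df z y| <= `|g y|) ->
  is_derive x 1 (fun z => \int[mu]_(y in `[- b, b]) f z y)
    (\int[mu]_(y in `[- b, b]) df x y).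
Proof.
move=> fdf cf cg dfg.
(* Differentiation under the integral is a local statement; since [g] dominates for every [z], any
   neighbourhood of [x] will do. *)
have ix : `](x - 1), (x + 1)[%classic x.
  by rewrite /= in_itv/= ltrBlDr ltrDl ltr01.
have int_f z : `](x - 1), (x + 1)[%classic z -> mu.-integrable `[- b, b] (EFin \o f z).
  by move=> _; apply: integrable_segment.
have der z y : `](x - 1), (x + 1)[%classic z -> `[- b, b]%classic y ->
  derivable (f ^~ y) z 1 by move=> _ _; apply: (@ex_derive _ _ _ _ _ _ _ (fdf y z)).
have d1 z y : partial1of2 f z y = df z y.
  by rewrite partial1of2E; apply: (@derive_val _ _ _ _ _ _ _ (fdf y z)).
have intg : mu.-integrable `[- b, b] (EFin \o (fun y => `|g y|)).
  by apply: integrable_segment => y; apply: cvg_norm; exact: cg.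
have ub z y : `](x - 1), (x + 1)[%classic z -> `[- b, b]%classic y ->
  `|partial1of2 f z y| <= `|g y| by rewrite d1.
have mI : measurable (`[- b, b]%classic : set (measurableTypeR R)) by exact: measurable_itv.
apply: DeriveDef.
  exact: (derivable_under_integral mI ix int_f der _ intg ub).
rewrite -derive1E (differentiation_under_integral mI ix int_f der _ intg ub)//.
by apply: eq_Rintegral => y _; rewrite -d1.
Qed.

Lemma is_derive_cosT G x : test_fun b G ->
  is_derive x 1 (cosT G) (- sinT (fun y => y * G y) x).
Proof.
move=> tG; have cG := test_continuous b_gt0 tG.
have cyG := test_continuous b_gt0 (test_mulX tG).
have h := @is_derive_under (fun z y => G y * cos (y * z))
  (fun z y => G y * (- y * sin (y * z))) (fun y => y * G y) x.
apply: is_derive_eq; first apply: h => //.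
- by move=> y z; apply: is_derive1Z; exact: is_derive1_cosM.
- by move=> z y; apply: continuousM; [exact: cG|exact: continuous_cosM].
- move=> z y; rewrite mulrA mulrN (mulrC (G y)) normrM normrN ler_piMr//.
  by rewrite ler_norml sin_geN1 sin_le1.
- rewrite /sinT -[RHS]mulN1r -RintegralZl//; last exact/integrable_sinT/test_mulX.
  by apply: eq_Rintegral => y _; ring.
Qed.

Lemma is_derive_sinT G x : test_fun b G ->
  is_derive x 1 (sinT G) (cosT (fun y => y * G y) x).
Proof.
move=> tG; have cG := test_continuous b_gt0 tG.
have cyG := test_continuous b_gt0 (test_mulX tG).
have h := @is_derive_under (fun z y => G y * sin (y * z))
  (fun z y => G y * (y * cos (y * z))) (fun y => y * G y) x.
apply: is_derive_eq; first apply: h => //.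
- by move=> y z; apply: is_derive1Z; exact: is_derive1_sinM.
- by move=> z y; apply: continuousM; [exact: cG|exact: continuous_sinM].
- move=> z y; rewrite mulrA (mulrC (G y)) normrM ler_piMr//.
  by rewrite ler_norml cos_geN1 cos_le1.
- by apply: eq_Rintegral => y _; ring.
Qed.

(** The boundary terms vanish because [G] is zero at both endpoints. *)
Lemma by_parts G G' (f df : R -> R) : test_fun b G -> test_fun b G' ->
  (forall y : R, `|y| < b -> is_derive y 1 G (G' y)) ->
  (forall y : R, is_derive y 1 f (df y)) -> continuous df ->
  \int[mu]_(y in `[- b, b]) (G y * df y) =
  - \int[mu]_(y in `[- b, b]) (G' y * f y).
Proof.
move=> tG tG' dG df' cdf.
have cG := test_continuous b_gt0 tG; have cG' := test_continuous b_gt0 tG'.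
have cf : continuous f by move=> y; exact: is_derive1_continuous (df' y).
have G0 : G (- b) = 0 /\ G b = 0.
  by split; apply: (test_outside tG); rewrite ?normrN ler_norm.
rewrite (@Rintegration_by_parts R G f G' df)//.
- by rewrite G0.1 G0.2 !mul0r subr0 sub0r.
- by rewrite gtrN.
- exact: continuous_subspaceT.
- split.
  + move=> y; rewrite in_itv/= -ltr_norml => yb.
    exact: (@ex_derive _ _ _ _ _ _ _ (dG y yb)).
  + exact: cvg_at_right_filter (cG _).
  + exact: cvg_at_left_filter (cG _).
- move=> y; rewrite in_itv/= -ltr_norml => yb.
  by rewrite derive1E; apply: (@derive_val _ _ _ _ _ _ _ (dG y yb)).
- exact: continuous_subspaceT.
- split.
  + by move=> y _; apply: (@ex_derive _ _ _ _ _ _ _ (df' y)).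
  + exact: cvg_at_right_filter (cf _).
  + exact: cvg_at_left_filter (cf _).
- move=> y _; rewrite derive1E.
  by apply: (@derive_val _ _ _ _ _ _ _ (df' y)).
Qed.

(** The factor [x * cos (y * x)] is the derivative in [y] of [sin (y * x)]; integration by parts
    moves the derivative to [G]. The sign is written [-1 *] to fit [schwartz1_scale]. *)
Lemma mulX_cosT G : test_fun b G -> exists2 G', test_fun b G' &
  forall x, x * cosT G x = -1 * sinT G' x.
Proof.
move=> tG; have [G' tG' dG] := test_derive b_gt0 tG; exists G' => // x.
have ds (y : R) : is_derive y 1 (fun z => sin (z * x)) (x * cos (y * x)).
  under eq_fun do rewrite mulrC.
  by rewrite (mulrC y); exact: is_derive1_sinM.
have cs : continuous (fun y => x * cos (y * x)).
  by move=> y; apply: continuousM; [exact: cvg_cst|exact: continuous_cosM].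
rewrite mulN1r -(by_parts tG tG' dG ds cs) -RintegralZl//; last exact: integrable_cosT.
by apply: eq_Rintegral => y _; ring.
Qed.

Lemma mulX_sinT G : test_fun b G -> exists2 G', test_fun b G' &
  forall x, x * sinT G x = cosT G' x.
Proof.
move=> tG; have [G' tG' dG] := test_derive b_gt0 tG; exists G' => // x.
have dc (y : R) : is_derive y 1 (fun z => cos (z * x)) (- x * sin (y * x)).
  under eq_fun do rewrite mulrC.
  by rewrite (mulrC y); exact: is_derive1_cosM.
have cc : continuous (fun y => - x * sin (y * x)).
  move=> y; apply: (@continuousM _ _ (fun=> - x) (fun y => sin (y * x)));
    [exact: cvg_cst|exact: continuous_sinM].
apply: oppr_inj; rewrite -(by_parts tG tG' dG dc cc) -mulNr -RintegralZl//.
  by apply: eq_Rintegral => y _; ring.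
exact: integrable_sinT.
Qed.

Lemma bounded_under (f : R -> R -> R) (g : R -> R) :
  (forall z, continuous (f z)) -> continuous g ->
  (forall z y, `|f z y| <= `|g y|) ->
  exists C : R, forall z, `|\int[mu]_(y in `[- b, b]) f z y| <= C.
Proof.
move=> cf cg fg; exists (\int[mu]_(y in `[- b, b]) `|g y|) => z.
have if_ := integrable_segment (cf z).
have mI : measurable (`[- b, b]%classic : set (measurableTypeR R)) by exact: measurable_itv.
rewrite (le_trans (le_normr_Rintegral mI if_))// le_Rintegral//.
- apply: (@integrable_segment (fun y => `|f z y|)) => y; apply: cvg_norm; exact: cf.
- apply: (@integrable_segment (fun y => `|g y|)) => y; apply: cvg_norm; exact: cg.
Qed.

Lemma cosT_bounded G : test_fun b G -> exists C : R, forall x, `|cosT G x| <= C.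
Proof.
move=> tG; have cG := test_continuous b_gt0 tG.
apply: (@bounded_under (fun x y => G y * cos (y * x)) G) => //.
- by move=> z y; apply: continuousM; [exact: cG|exact: continuous_cosM].
- by move=> z y; rewrite normrM ler_piMr// ler_norml cos_geN1 cos_le1.
Qed.

Lemma sinT_bounded G : test_fun b G -> exists C : R, forall x, `|sinT G x| <= C.
Proof.
move=> tG; have cG := test_continuous b_gt0 tG.
apply: (@bounded_under (fun x y => G y * sin (y * x)) G) => //.
- by move=> z y; apply: continuousM; [exact: cG|exact: continuous_sinM].
- by move=> z y; rewrite normrM ler_piMr// ler_norml sin_geN1 sin_le1.
Qed.

(** Since the second derivative of [cosT G] is minus the transform of [y^2 G], the left side is
    [-(C'' + xi^2 C)] for [C = cosT G]. *)
Lemma cosT_sqrB G xi x : test_fun b G ->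
  cosT (fun y => y * (y * G y)) x - xi ^+ 2 * cosT G x =
  cosT (fun y => (y ^+ 2 - xi ^+ 2) * G y) x.
Proof.
move=> tG; rewrite /cosT -RintegralZl//; last exact: integrable_cosT.
rewrite -RintegralB//.
- by apply: eq_Rintegral => y _; ring.
- exact/integrable_cosT/test_mulX/test_mulX.
- apply: (@integrable_segment (fun y => xi ^+ 2 * (G y * cos (y * x)))) => y.
  apply: (@continuousM _ _ (fun=> xi ^+ 2) (fun y => G y * cos (y * x))).
    exact: cvg_cst.
  by apply: continuousM; [exact: (test_continuous b_gt0 tG)|exact: continuous_cosM].
Qed.

End transforms.

(** * Schwartz functions generated by the transforms *)

Section schwartz_functions.
Context {R : realType}.
Variable b : R.
Hypothesis b_gt0 : 0 < b.
Implicit Types (x c : R) (f g : R -> R).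

(* Members are bounded and the class is closed under differentiation and under
   multiplication by [x], so that they are Schwartz functions. *)
Inductive schwartz1 : (R -> R) -> Prop :=
| schwartz1_cosT G : test_fun b G -> schwartz1 (cosT b G)
| schwartz1_sinT G : test_fun b G -> schwartz1 (sinT b G)
| schwartz1_add f g : schwartz1 f -> schwartz1 g -> schwartz1 (fun x => f x + g x)
| schwartz1_scale c f : schwartz1 f -> schwartz1 (fun x => c * f x)
| schwartz1_mul f g : schwartz1 f -> schwartz1 g -> schwartz1 (fun x => f x * g x)
| schwartz1_mulcos c f : schwartz1 f -> schwartz1 (fun x => f x * cos (c * x))
| schwartz1_mulsin c f : schwartz1 f -> schwartz1 (fun x => f x * sin (c * x)).

Lemma schwartz1_derive f : schwartz1 f ->
  exists2 f', schwartz1 f' & forall x, is_derive x 1 f (f' x).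
Proof.
elim=> [G tG|G tG|{}f g _ [f' sf' df] _ [g' sg' dg]|c {}f _ [f' sf' df]
  |{}f g sf [f' sf' df] sg [g' sg' dg]|c {}f sf [f' sf' df]|c {}f sf [f' sf' df]].
- exists (fun x => -1 * sinT b (fun y => y * G y) x).
    exact/schwartz1_scale/schwartz1_sinT/test_mulX.
  by move=> x; rewrite mulN1r; exact: is_derive_cosT.
- exists (cosT b (fun y => y * G y)); first exact/schwartz1_cosT/test_mulX.
  by move=> x; exact: is_derive_sinT.
- exists (fun x => f' x + g' x); first exact: schwartz1_add.
  by move=> x; exact: is_derive1D.
- exists (fun x => c * f' x); first exact: schwartz1_scale.
  by move=> x; exact: is_derive1Z.
- exists (fun x => f' x * g x + f x * g' x).
    by apply: schwartz1_add; exact: schwartz1_mul.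
  by move=> x; exact: is_derive1M.
- exists (fun x => f' x * cos (c * x) + - c * (f x * sin (c * x))).
    by apply: schwartz1_add; [exact: schwartz1_mulcos|exact/schwartz1_scale/schwartz1_mulsin].
  move=> x; have h := is_derive1M (df x) (is_derive1_cosM x c).
  by apply: (is_derive_eq h); rewrite (mulrCA (f x)).
- exists (fun x => f' x * sin (c * x) + c * (f x * cos (c * x))).
    by apply: schwartz1_add; [exact: schwartz1_mulsin|exact/schwartz1_scale/schwartz1_mulcos].
  move=> x; have h := is_derive1M (df x) (is_derive1_sinM x c).
  by apply: (is_derive_eq h); rewrite (mulrCA (f x)).
Qed.

Lemma schwartz1_mulX f : schwartz1 f -> schwartz1 (fun x => x * f x).
Proof.
elim=> [G tG|G tG|{}f g _ ihf _ ihg|c {}f _ ihf|{}f g _ ihf sg _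
    |c {}f _ ihf|c {}f _ ihf].
- have [G' tG' GG'] := mulX_cosT b_gt0 tG.
  by rewrite (funext GG'); exact/schwartz1_scale/schwartz1_sinT.
- have [G' tG' GG'] := mulX_sinT b_gt0 tG.
  by rewrite (funext GG'); exact/schwartz1_cosT.
- by under eq_fun do rewrite mulrDr; exact: schwartz1_add.
- by under eq_fun do rewrite mulrCA; exact: schwartz1_scale.
- by under eq_fun do rewrite mulrA; exact: (schwartz1_mul ihf).
- by under eq_fun do rewrite mulrA; exact: (schwartz1_mulcos c ihf).
- by under eq_fun do rewrite mulrA; exact: (schwartz1_mulsin c ihf).
Qed.

Lemma schwartz1_bounded f : schwartz1 f -> exists C : R, forall x, `|f x| <= C.
Proof.
elim=> [G tG|G tG|{}f g _ [C fC] _ [D gD]|c {}f _ [C fC]|{}f g _ [C fC] _ [D gD]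
    |c {}f _ [C fC]|c {}f _ [C fC]].
- exact: cosT_bounded.
- exact: sinT_bounded.
- by exists (C + D) => x; rewrite (le_trans (ler_normD _ _))// lerD.
- by exists (`|c| * C) => x; rewrite normrM ler_wpM2l.
- by exists (C * D) => x; rewrite normrM ler_pM.
- exists C => x; rewrite normrM (le_trans _ (fC x))// ler_piMr//.
  by rewrite ler_norml cos_geN1 cos_le1.
- exists C => x; rewrite normrM (le_trans _ (fC x))// ler_piMr//.
  by rewrite ler_norml sin_geN1 sin_le1.
Qed.

Lemma schwartz1_continuous f : schwartz1 f -> continuous f.
Proof.
by move=> /schwartz1_derive[f' _ df] x; exact: is_derive1_continuous (df x).
Qed.

Lemma schwartz1_mulXn f n : schwartz1 f -> schwartz1 (fun x => x ^+ n * f x).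
Proof.
move=> sf; elim: n => [|n ih]; first by under eq_fun do rewrite expr0 mul1r.
by under eq_fun do rewrite exprS -mulrA; exact: (schwartz1_mulX ih).
Qed.

(** The function [(1 + x^2) f x] is again in the class, hence bounded. This rate gives integrability
    and limits at infinity. *)
Lemma schwartz1_decay f : schwartz1 f -> exists2 C : R, 0 < C &
  forall x, `|f x| <= C / oneDsqr x.
Proof.
move=> sf; have [C fC] := schwartz1_bounded (schwartz1_add sf (schwartz1_mulXn 2 sf)).
exists (`|C| + 1); first by rewrite ltr_wpDl.
move=> x; have x0 : 0 < 1 + x ^+ 2 by rewrite ltr_wpDr ?sqr_ge0.
rewrite /oneDsqr ler_pdivlMr// -[1 + _]gtr0_norm// -normrM mulrC mulrDl mul1r.
by rewrite (le_trans (fC x))// (le_trans (ler_norm C))// lerDl.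
Qed.

(** On row vectors of length one, the difference quotient along [delta_mx 0 i] is the one-variable
    quotient, so both derivatives are the same limit. *)
Lemma derive_coord (f : R -> R) (v : 'rV[R]_1) (i : 'I_1) (df : R) :
  is_derive (v 0 0) 1 f df ->
  is_derive v (delta_mx 0 i) (fun w : 'rV[R]_1 => f (w 0 0)) df.
Proof.
have E : (fun h : R => h^-1 *: (((fun w : 'rV[R]_1 => f (w 0 0)) \o shift v)
    (h *: delta_mx 0 i) - f (v 0 0))) =
  (fun h => h^-1 *: ((f \o shift (v 0 0)) (h *: 1) - f (v 0 0))).
  apply/funext => h /=; congr (_ *: (f _ - _)).
  by rewrite !mxE !ord1 eqxx.
move=> [+ <-]; rewrite /derivable /derive => d.
by apply: DeriveDef; rewrite /derivable /derive E.
Qed.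

Lemma schwartz1_partial f (s : seq 'I_1) : schwartz1 f ->
  exists2 g, schwartz1 g & partial s (fun w : 'rV[R]_1 => f (w 0 0)) = fun w => g (w 0 0).
Proof.
move=> sf; elim: s => [|i s [g sg /= ->]]; first by exists f.
have [g' sg' dg] := schwartz1_derive sg; exists g' => //; apply/funext => w.
exact: (@derive_val _ _ _ _ _ _ _ (derive_coord i (dg (w 0 0)))).
Qed.

Lemma schwartz1_smooth f : schwartz1 f -> smooth (fun w : 'rV[R]_1 => f (w 0 0)).
Proof.
move=> sf s; have [g sg ->] := schwartz1_partial s sf; split => [w|i w].
  apply: (@continuous_comp _ _ _ (fun w : 'rV[R]_1 => w 0 0) g).
    exact: coord_continuous.
  exact: schwartz1_continuous.
have [g' sg' dg] := schwartz1_derive sg.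
exact: (@ex_derive _ _ _ _ _ _ _ (derive_coord i (dg (w 0 0)))).
Qed.

Lemma schwartz1_rapidly_decreasing f : schwartz1 f ->
  rapidly_decreasing (fun w : 'rV[R]_1 => f (w 0 0)).
Proof.
move=> sf s alpha; have [g sg ->] := schwartz1_partial s sf.
have [C gC] := schwartz1_bounded (schwartz1_mulXn (alpha 0) sg).
by exists C => w; rewrite big_ord1; exact: gC.
Qed.

(** Serves as the imaginary part in [schwartz1_lift]; the class has no constructor for constants, so
    zero is a null multiple of a transform. *)
Lemma sch0 : schwartz1 (fun=> 0).
Proof.
rewrite (_ : (fun=> 0) = (fun x => 0 * cosT b (bump b) x)).
  exact/schwartz1_scale/schwartz1_cosT/test_bump.
by apply/funext => x; rewrite mul0r.
Qed.

Lemma schwartz1_lift f : schwartz1 f ->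
  schwartz (fun w : 'rV[R]_1 => Complex (f (w 0 0)) 0).
Proof.
move=> sf; split=> /=.
- exact: schwartz1_smooth.
- exact: schwartz1_smooth sch0.
- exact: schwartz1_rapidly_decreasing.
- exact: schwartz1_rapidly_decreasing sch0.
Qed.

End schwartz_functions.

(** * Fourier supports *)

Section fourier_support.
Context {R : realType}.
Variable b : R.
Hypothesis b_gt0 : 0 < b.
Implicit Types (x c xi beta : R) (f g F G : R -> R).
Local Notation mu := (@lebesgue_measure R).
Local Notation schwartz1 := (schwartz1 b).

Lemma integrable_oneDsqrV : mu.-integrable setT (fun x => (oneDsqr x)^-1%:E).
Proof.
apply/integrableP; split.
  apply/measurable_EFinP; apply: continuous_measurable_fun; exact: continuous_oneDsqrV.
under eq_integral do rewrite gee0_abs ?lee_fin ?invr_ge0//.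
rewrite (ge0_symfun_integralT (f := fun x => (oneDsqr x)^-1)).
- by rewrite -set_itvcy integral0y_oneDsqr -EFinM ltry.
- by move=> x; rewrite invr_ge0.
- exact: continuous_oneDsqrV.
- by move=> x; rewrite /oneDsqr /= sqrrN.
Qed.

Lemma schwartz1_integrable f : schwartz1 f -> mu.-integrable setT (EFin \o f).
Proof.
move=> sf; have [C C0 fC] := schwartz1_decay b_gt0 sf.
have iC := integrableZl measurableT C integrable_oneDsqrV.
apply: (le_integrable measurableT _ _ iC).
  apply/measurable_EFinP; apply: continuous_measurable_fun; exact: (schwartz1_continuous b_gt0).
by move=> x _; rewrite /= lee_fin (le_trans (fC x))// ler_norm.
Qed.

Lemma schwartz1_cvg0 f : schwartz1 f ->
  (f n.+1%:R @[n --> \oo] --> 0) /\ (f (- n.+1%:R) @[n --> \oo] --> 0).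
Proof.
move=> sf; have [C C0 fC] := schwartz1_decay b_gt0 sf.
(* The sign [s] treats both ends at once. The decay is weakened to [C / (n + 1)] so that the
   harmonic sequence applies. *)
have B n (s : R) : `|s| = 1 -> `|f (s * n.+1%:R)| <= C * n.+1%:R^-1.
  move=> s1; rewrite (le_trans (fC _))// ler_pM2l// lef_pV2 ?posrE//.
  rewrite /oneDsqr exprMn -(real_normK (num_real s)) s1 expr1n mul1r.
  rewrite (@le_trans _ _ (n.+1%:R ^+ 2))//; last by rewrite lerDr.
  by rewrite -natrX ler_nat leq_pmulr.
have H (s : R) : `|s| = 1 -> f (s * n.+1%:R) @[n --> \oo] --> 0.
  move=> s1; apply/norm_cvg0P.
  apply: (@squeeze_cvgr _ _ _ _ (fun=> 0) (fun n => C * n.+1%:R^-1)).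
  - by near=> n; rewrite normr_ge0 B.
  - exact: cvg_cst.
  - rewrite -(mulr0 C); apply: cvgM; first exact: cvg_cst.
    exact: cvg_harmonic.
split.
- by have := H 1 (normr1 _); under eq_fun do rewrite mul1r.
- by have := H (- 1) (normrN1 _); under eq_fun do rewrite mulN1r.
Unshelve. all: by end_near. Qed.

(** By the fundamental theorem of calculus the integral over [[-(n+1), n+1]] is a difference of
    values of [F] that tends to zero; dominated convergence, with majorant [|f|], identifies the
    limit with the whole integral. *)
Lemma Rintegral_derivative F f : schwartz1 F -> schwartz1 f ->
  (forall x, is_derive x 1 F (f x)) -> \int[mu]_x f x = 0.
Proof.
move=> sF sf dF.
pose f_ n : R -> R := f \_ `[- n.+1%:R, n.+1%:R]%classic.
have mI n : measurable (`[- n.+1%:R, n.+1%:R]%classic : set (measurableTypeR R)).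
  exact: measurable_itv.
have mf : measurable_fun (setT : set (measurableTypeR R)) f.
  by apply: continuous_measurable_fun; exact: (schwartz1_continuous b_gt0).
have mf_ n : measurable_fun (setT : set (measurableTypeR R)) (EFin \o f_ n).
  apply/measurable_EFinP; apply/(measurable_restrictT _ (mI n)).
  exact: measurable_funTS.
have cvgf : {ae mu, forall x, setT x -> (EFin \o f_ n) x @[n --> \oo] --> (EFin \o f) x}.
  apply: aeW => x _; apply: cvg_near_cst; near=> n.
  rewrite /f_ /= patchE mem_set//= in_itv/= -ler_norml.
  have : `|x| <= n%:R by near: n; exact: nbhs_infty_ger.
  by move=> /le_trans; apply; rewrite ler_nat.
have ig : mu.-integrable setT (fun x => `|f x|%:E) := integrable_norm (schwartz1_integrable sf).
have dom : {ae mu, forall x n, setT x -> (`|(EFin \o f_ n) x| <= `|f x|%:E)%E}.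
  apply: aeW => x n _; rewrite /f_ /= patchE; case: ifPn => // _.
  (* Outside the interval the restriction takes the default element [point], which is [0] in [R]. *)
  by rewrite [point](_ : _ = 0 :> R)// normr0 lee_fin.
have [_ _ lim] := dominated_convergence measurableT mf_
  (proj2 (measurable_EFinP _ _) mf) cvgf ig dom.
have lim0 : [sequence (\int[mu]_x (EFin \o f_ n) x)%E]_n @ \oo --> 0%:E.
  have E n : (\int[mu]_x (EFin \o f_ n) x = (F n.+1%:R - F (- n.+1%:R))%:E)%E.
    rewrite -restrict_EFin -integral_mkcond.
    rewrite (@continuous_FTC2 _ f F) ?EFinB//.
    - by rewrite gtrN.
    - by apply: continuous_subspaceT; exact: (schwartz1_continuous b_gt0).
    - have cF := schwartz1_continuous b_gt0 sF; split.
      + by move=> x _; apply: (@ex_derive _ _ _ _ _ _ _ (dF x)).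
      + exact: cvg_at_right_filter (cF _).
      + exact: cvg_at_left_filter (cF _).
    - by move=> x _; rewrite derive1E; apply: (@derive_val _ _ _ _ _ _ _ (dF x)).
  rewrite [X in X @ _](_ : _ = EFin \o (fun n => F n.+1%:R - F (- n.+1%:R))); last first.
    by apply/funext => n /=; rewrite E.
  have [F1 F2] := schwartz1_cvg0 sF.
  by apply: cvg_EFin; [near=> n|rewrite -(subr0 0); exact: cvgB].
by rewrite /Rintegral (cvg_unique _ lim lim0).
Unshelve. all: by end_near. Qed.

(** The Fourier transform, in angular frequency, is supported in [[-beta, beta]]; its real and
    imaginary parts are stated separately to stay with real integrals. *)
Definition band_limited beta f := forall xi, beta < `|xi| ->
  \int[mu]_x (f x * cos (xi * x)) = 0 /\ \int[mu]_x (f x * sin (xi * x)) = 0.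

(* With [H = G / (y^2 - xi^2)], the transform [C] of [H] satisfies
   [C'' + xi^2 C = - cosT G], so [cosT G x * cos (xi x)] is the derivative of
   [- (C' cos (xi x) + xi C sin (xi x))]. *)
Lemma band_limited_cosT G : test_fun b G -> band_limited b (cosT b G).
Proof.
move=> tG xi bxi.
pose H y := G y / (y ^+ 2 - xi ^+ 2).
have tH : test_fun b H by apply: test_div => //; exact: ltW.
have CG x : cosT b G x = cosT b (fun y => y * (y * H y)) x - xi ^+ 2 * cosT b H x.
  rewrite (cosT_sqrB b_gt0)//; apply: eq_Rintegral => y.
  rewrite inE/= in_itv/= -ler_norml => yb; rewrite /H mulrCA divff ?mulr1//.
  have -> : y ^+ 2 - xi ^+ 2 = (y - xi) * (y + xi) by ring.
  rewrite mulf_neq0 ?subr_eq0 ?addr_eq0//.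
  - by apply: contraTneq bxi => <-; rewrite -leNgt.
  - by apply: contraTneq bxi => yxi; rewrite -leNgt -normrN -yxi.
have dC x := is_derive_cosT b_gt0 x tH.
have dS x := is_derive_sinT b_gt0 x (test_mulX tH).
have sC : schwartz1 (cosT b H) by exact: schwartz1_cosT.
have sS : schwartz1 (sinT b (fun y => y * H y)) by exact/schwartz1_sinT/test_mulX.
have sG : schwartz1 (cosT b G) by exact: schwartz1_cosT.
split.
- apply: (@Rintegral_derivative
    (fun x => sinT b (fun y => y * H y) x * cos (xi * x)
      + - xi * (cosT b H x * sin (xi * x)))).
  + by apply: schwartz1_add; [exact: schwartz1_mulcos|exact/schwartz1_scale/schwartz1_mulsin].
  + exact: schwartz1_mulcos.
  + move=> x; have h := is_derive1D (is_derive1M (dS x) (is_derive1_cosM x xi))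
      (is_derive1Z (- xi) (is_derive1M (dC x) (is_derive1_sinM x xi))).
    by apply: (is_derive_eq h); rewrite CG; ring.
(* The companion antiderivative for the sine is [- C' sin (xi x) + xi C cos (xi x)], where [C'] is
   [- sinT (y H)]. *)
- apply: (@Rintegral_derivative
    (fun x => sinT b (fun y => y * H y) x * sin (xi * x)
      + xi * (cosT b H x * cos (xi * x)))).
  + by apply: schwartz1_add; [exact: schwartz1_mulsin|exact/schwartz1_scale/schwartz1_mulcos].
  + exact: schwartz1_mulsin.
  + move=> x; have h := is_derive1D (is_derive1M (dS x) (is_derive1_sinM x xi))
      (is_derive1Z xi (is_derive1M (dC x) (is_derive1_cosM x xi))).
    by apply: (is_derive_eq h); rewrite CG; ring.
Qed.

Lemma band_limitedD beta f g : schwartz1 f -> schwartz1 g -> band_limited beta f ->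
  band_limited beta g -> band_limited beta (fun x => f x + g x).
Proof.
move=> sf sg bf bg xi bxi; have [f1 f2] := bf xi bxi; have [g1 g2] := bg xi bxi.
have i1 k (sk : schwartz1 k) := schwartz1_integrable (schwartz1_mulcos xi sk).
have i2 k (sk : schwartz1 k) := schwartz1_integrable (schwartz1_mulsin xi sk).
split.
- under eq_Rintegral do rewrite mulrDl.
  by rewrite RintegralD//; [rewrite f1 g1 addr0|exact: i1|exact: i1].
- under eq_Rintegral do rewrite mulrDl.
  by rewrite RintegralD//; [rewrite f2 g2 addr0|exact: i2|exact: i2].
Qed.

Lemma band_limitedZ beta c f : schwartz1 f -> band_limited beta f ->
  band_limited beta (fun x => c * f x).
Proof.
move=> sf bf xi bxi; have [f1 f2] := bf xi bxi; split.
- under eq_Rintegral do rewrite -mulrA.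
  by rewrite RintegralZl ?f1 ?mulr0//; exact: (schwartz1_integrable (schwartz1_mulcos xi sf)).
- under eq_Rintegral do rewrite -mulrA.
  by rewrite RintegralZl ?f2 ?mulr0//; exact: (schwartz1_integrable (schwartz1_mulsin xi sf)).
Qed.

Lemma band_limitedW beta beta' f : beta <= beta' -> band_limited beta f ->
  band_limited beta' f.
Proof. by move=> bb bf xi bxi; apply: bf; exact: le_lt_trans bxi. Qed.

(** Modulation moves the spectrum by [c] and [-c]: the product formulas leave the frequencies
    [xi + c] and [xi - c], both beyond [beta]. *)
Lemma band_limited_mulcos beta c f : schwartz1 f -> band_limited beta f ->
  band_limited (beta + `|c|) (fun x => f x * cos (c * x)).
Proof.
move=> sf bf xi bxi.
have bD : beta < `|xi + c|.
  by rewrite -ltrBDr in bxi; rewrite (lt_le_trans bxi)// lerBlDr -{1}(addrK c xi) ler_normB.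
have bB : beta < `|xi - c|.
  rewrite -ltrBDr in bxi; rewrite (lt_le_trans bxi)// lerBlDr.
  by rewrite -{1}(subrK c xi) ler_normD.
have [D1 D2] := bf _ bD; have [B1 B2] := bf _ bB.
split.
- have E x : f x * cos (c * x) * cos (xi * x) = 2^-1 * (f x * cos ((xi + c) * x)
     + f x * cos ((xi - c) * x)).
    by rewrite mulrDl mulrBl cosD cosB; field.
  under eq_Rintegral do rewrite E.
  rewrite RintegralZl//; last first.
    by apply: schwartz1_integrable; apply: schwartz1_add; exact: schwartz1_mulcos.
  rewrite RintegralD//; [|by apply: schwartz1_integrable; exact: schwartz1_mulcos..].
  by rewrite D1 B1 addr0 mulr0.
- have E x : f x * cos (c * x) * sin (xi * x) = 2^-1 * (f x * sin ((xi + c) * x)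
     + f x * sin ((xi - c) * x)).
    by rewrite mulrDl mulrBl sinD sinB; field.
  under eq_Rintegral do rewrite E.
  rewrite RintegralZl//; last first.
    by apply: schwartz1_integrable; apply: schwartz1_add; exact: schwartz1_mulsin.
  rewrite RintegralD//; [|by apply: schwartz1_integrable; exact: schwartz1_mulsin..].
  by rewrite D2 B2 addr0 mulr0.
Qed.

End fourier_support.

(** * Fourier support of products *)

Section product_fourier_support.
Context {R : realType}.
Variable b : R.
Hypothesis b_gt0 : 0 < b.
Implicit Types (x c xi beta : R) (f g F G K : R -> R).
Local Notation mu := (@lebesgue_measure R).
Local Notation schwartz1 := (schwartz1 b).

Lemma cosTE G x : test_fun b G -> cosT b G x = \int[mu]_z (G z * cos (z * x)).
Proof.
move=> tG; rewrite /cosT Rintegral_mkcond; apply: eq_Rintegral => z _.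
rewrite patchE; case: ifPn => //; rewrite notin_setE/= in_itv/= -ler_norml.
move=> /negP; rewrite -ltNge => /ltW bz; rewrite (test_outside tG bz) mul0r.
by [].
Qed.

Lemma test_integrable G : test_fun b G -> mu.-integrable setT (EFin \o G).
Proof.
move=> tG.
have := @integrable_segment _ b _ (test_continuous b_gt0 tG).
rewrite integrable_mkcond//; apply: eq_integrable => // z _.
rewrite /= patchE; case: ifPn => //; rewrite notin_setE/= in_itv/= -ler_norml.
by move=> /negP; rewrite -ltNge => /ltW bz; rewrite (test_outside tG bz).
Qed.

(** Writes [f * cosT G] as a superposition of the modulations [f x * cos (z * x)] with weight [G z].
    The kernel [K] will be [cos (xi * x)] or [sin (xi * x)]. *)
Lemma Fubini_cosT f G K : schwartz1 f -> test_fun b G -> continuous K ->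
  (forall x, `|K x| <= 1) ->
  \int[mu]_x (f x * cosT b G x * K x) =
  \int[mu]_z (G z * \int[mu]_x (f x * cos (z * x) * K x)).
Proof.
move=> sf tG cK K1.
pose h (p : R * R) : R := f p.1 * (G p.2 * cos (p.2 * p.1)) * K p.1.
pose g (p : R * R) : R := f p.1 * G p.2.
pose RR := (measurableTypeR R * measurableTypeR R)%type.
have mf : measurable_fun (setT : set (measurableTypeR R)) f.
  by apply: continuous_measurable_fun; exact: (schwartz1_continuous b_gt0).
have mG : measurable_fun (setT : set (measurableTypeR R)) G.
  by apply: continuous_measurable_fun; exact: (test_continuous b_gt0).
have mK : measurable_fun (setT : set (measurableTypeR R)) K.
  exact: continuous_measurable_fun.
have mc : measurable_fun (setT : set (measurableTypeR R)) (@cos R).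
  by apply: continuous_measurable_fun; exact: continuous_cos.
have m1 : measurable_fun (setT : set RR) (fun p : RR => f p.1).
  exact: measurableT_comp measurable_fst.
have m2 : measurable_fun (setT : set RR) (fun p : RR => G p.2).
  exact: measurableT_comp measurable_snd.
have m3 : measurable_fun (setT : set RR) (fun p : RR => K p.1).
  exact: measurableT_comp measurable_fst.
have m4 : measurable_fun (setT : set RR) (fun p : RR => cos (p.2 * p.1 : R)).
  apply: (measurableT_comp mc).
  by apply: measurable_funM; [exact: measurable_snd|exact: measurable_fst].
have mg : measurable_fun (setT : set RR) (EFin \o g).
  by apply/measurable_EFinP; exact: measurable_funM.
have mh : measurable_fun (setT : set RR) (EFin \o h).
  apply/measurable_EFinP; apply: measurable_funM => //.
  by apply: measurable_funM => //; exact: measurable_funM.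
have if_ := schwartz1_integrable b_gt0 sf.
have iG := test_integrable tG.
(* The majorant [f x * G z] separates the variables, so its iterated integral is a product of two
   finite ones. *)
have ig : (mu \x mu)%E.-integrable (setT : set RR) (EFin \o g).
  apply/integrable12ltyP => //.
  have E x : (\int[mu]_y `|(EFin \o g) (x, y)| =
     `|f x|%:E * \int[mu]_y `|G y|%:E)%E.
    rewrite -ge0_integralZl//.
    - by apply: eq_integral => y _; rewrite /g /= normrM EFinM.
    - by apply/measurable_EFinP; exact: measurableT_comp.
  under eq_integral do rewrite E.
  have /integrableP[_ lf] := if_; have /integrableP[_ lG] := iG.
  have G0 : (0 <= \int[mu]_y `|G y|%:E)%E by exact: integral_ge0.
  rewrite ge0_integralZr//.
  - by rewrite lte_mul_pinfty// ?integral_ge0// ge0_fin_numE ?integral_ge0.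
  - by apply/measurable_EFinP; exact: measurableT_comp.
have ih : (mu \x mu)%E.-integrable (setT : set RR) (EFin \o h).
  apply: (le_integrable measurableT mh _ ig) => -[x y] _.
  rewrite /= lee_fin /h /g /= normrM (le_trans (ler_piMr _ (K1 x)))//.
  rewrite !normrM ler_wpM2l// ler_piMr//.
  by rewrite ler_norml cos_geN1 cos_le1.
have Fub := Fubini ih.
rewrite /Rintegral; congr fine.
transitivity (\int[mu]_x \int[mu]_y (EFin \o h) (x, y))%E.
  apply: eq_integral => x _; rewrite cosTE//.
  have ix : mu.-integrable setT (fun y => (G y * cos (y * x))%:E).
    apply: (le_integrable measurableT _ _ iG).
      apply/measurable_EFinP; apply: measurable_funM => //.
      by apply: (measurableT_comp mc); exact: measurable_funM.
    move=> y _; rewrite /= lee_fin normrM ler_piMr//.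
    by rewrite ler_norml cos_geN1 cos_le1.
  rewrite mulrAC -RintegralZl//.
  rewrite /Rintegral fineK; last first.
    apply: integrable_fin_num => //.
    by under eq_fun do rewrite EFinM; exact: integrableZl.
  by apply: eq_integral => y _; rewrite /h /= mulrAC.
rewrite Fub; apply: eq_integral => z _.
have iz : mu.-integrable setT (fun x => (f x * cos (z * x) * K x)%:E).
  apply: (le_integrable measurableT _ _ if_).
    apply/measurable_EFinP; apply: measurable_funM => //.
    apply: measurable_funM => //.
    by apply: (measurableT_comp mc); exact: measurable_funM.
  move=> x _; rewrite /= lee_fin normrM (le_trans (ler_piMr _ (K1 x)))//.
  rewrite normrM ler_piMr//.
  by rewrite ler_norml cos_geN1 cos_le1.
rewrite -RintegralZl// /Rintegral fineK; last first.
  apply: integrable_fin_num => //.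
  by under eq_fun do rewrite EFinM; exact: integrableZl.
by apply: eq_integral => x _; rewrite /h /= !mulrA (mulrC (f x)).
Qed.

(** Spectra of factors add: only modulations with [|z| < b] carry weight, and each has its spectrum
    within [beta + |z|]. *)
Lemma band_limited_mul_cosT beta f G : schwartz1 f -> band_limited beta f ->
  test_fun b G -> band_limited (beta + b) (fun x => f x * cosT b G x).
Proof.
move=> sf bf tG xi bxi.
have H z : G z = 0 \/ \int[mu]_x (f x * cos (z * x) * cos (xi * x)) = 0 /\
    \int[mu]_x (f x * cos (z * x) * sin (xi * x)) = 0.
  have [bz|zb] := leP b `|z|; first by left; exact: test_outside tG z bz.
  right; apply: (@band_limited_mulcos _ _ b_gt0 beta z f sf bf).
  by rewrite (le_lt_trans _ bxi)// lerD2l ltW.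
split.
- rewrite (@Fubini_cosT f G (fun x => cos (xi * x)))//.
  + rewrite (_ : (fun z => _) = cst 0) ?Rintegral_cst//= ?mul0r//.
    by apply/funext => z; have [->|[-> _]] := H z; rewrite ?mul0r ?mulr0.
  + by move=> x; exact: is_derive1_continuous (is_derive1_cosM x xi).
  + by move=> x; rewrite ler_norml cos_geN1 cos_le1.
- rewrite (@Fubini_cosT f G (fun x => sin (xi * x)))//.
  + rewrite (_ : (fun z => _) = cst 0) ?Rintegral_cst//= ?mul0r//.
    by apply/funext => z; have [->|[_ ->]] := H z; rewrite ?mul0r ?mulr0.
  + by move=> x; exact: is_derive1_continuous (is_derive1_sinM x xi).
  + by move=> x; rewrite ler_norml sin_geN1 sin_le1.
Qed.

End product_fourier_support.

(** * A nonnegative band-limited function vanishing on a lattice *)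

Section nonnegative_band_limited.
Context {R : realType}.
Implicit Types (a b x : R).
Local Notation mu := (@lebesgue_measure R).

Lemma cosT_bump0_gt0 b : 0 < b -> 0 < cosT b (bump b) 0.
Proof.
move=> b0; have tb := test_bump b.
have cb := test_continuous b0 tb.
rewrite /cosT; under eq_Rintegral do rewrite mulr0 cos0 mulr1.
(* The value of the bump at [b / 2], hence its minimum on [[-b/2, b/2]]. *)
pose c := expR (- (b ^+ 2 - (b / 2) ^+ 2)^-1).
have ib := @integrable_segment _ b _ cb.
have cbump y : `[- (b / 2), b / 2]%classic y -> c <= bump b y.
  rewrite /= in_itv/= -ler_norml => yb.
  have yb' : `|y| < b by rewrite (le_lt_trans yb)// ltr_pdivrMr// ltr_pMr// ltr1n.
  have b2 : `|b / 2| < b.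
    by rewrite gtr0_norm ?divr_gt0// ltr_pdivrMr// ltr_pMr// ltr1n.
  rewrite /bump yb' ler_expR lerN2 lef_pV2 ?posrE ?subr_sqr_gt0//.
  rewrite lerD2l lerN2 -(real_normK (num_real y)) lerXn2r ?nnegrE//.
  by rewrite divr_ge0// ltW.
have bump_ge0 y : 0 <= bump b y by rewrite /bump; case: ifPn => // _; exact: expR_ge0.
apply: fine_gt0; apply/andP; split; last first.
  rewrite -ge0_fin_numE; first exact: (integrable_fin_num _ ib).
  by apply: integral_ge0 => y _; rewrite lee_fin.
have mb : measurable_fun (setT : set (measurableTypeR R)) (bump b).
  exact: continuous_measurable_fun.
apply: (@lt_le_trans _ _ (\int[mu]_(y in `[(- (b / 2))%R, (b / 2)%R]) c%:E)%E).
  rewrite integral_cst//= lebesgue_measure_itv/= lte_fin gtrN ?divr_gt0//.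
  by rewrite -EFinD -EFinM lte_fin mulr_gt0 ?expR_gt0// opprK addr_gt0 ?divr_gt0.
apply: (@le_trans _ _ (\int[mu]_(y in `[(- (b / 2))%R, (b / 2)%R]) (bump b y)%:E)%E).
  apply: ge0_le_integral => //.
  - by move=> y _; rewrite lee_fin expR_ge0.
  - by apply/measurable_EFinP; exact: measurable_funTS.
apply: ge0_subset_integral => //.
- by apply/measurable_EFinP; exact: measurable_funTS.
- by move=> y _; rewrite lee_fin.
- by apply: subset_itv; rewrite bnd_simp ?lerN2 ler_pdivrMr// ler_peMr// ?ler1n// ltW.
Qed.

Lemma cos_2piMz (k : int) : cos (2 * pi * k%:~R) = 1 :> R.
Proof.
have H (n : nat) : cos (2 * pi * n%:R) = 1 :> R.
  elim: n => [|n ih]; first by rewrite mulr0 cos0.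
  rewrite (_ : 2 * pi * _ = 2 * pi * n%:R + pi + pi); last first.
    by rewrite -natr1; ring.
  by rewrite !cosDpi opprK ih.
case: k => n; first exact: H.
by rewrite NegzE mulrNz mulrN cosN; exact: H.
Qed.

(** The same [d] is both a radius and a lower bound, so that the tent of height and radius [d] at
    [p] lies below [phi]. *)
Lemma exists_nonnegative_band_limited a B : 0 < a -> a^-1 < B ->
  exists b (phi : R -> R), [/\ 0 < b, schwartz1 b phi & forall x, 0 <= phi x] /\
  [/\ band_limited (2 * pi * B) phi,
      forall k : int, phi (a * k%:~R) = 0 &
      exists p d : R, 0 < d /\ forall x, `|x - p| <= d -> d <= phi x].
Proof.
move=> a0 aB; pose w : R := 2 * pi / a.
have pi0 := pi_gt0 R.
have w0 : 0 < w by rewrite !mulr_gt0 ?invr_gt0.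
(* Squaring [h] doubles its band and the factor [cos (w * x)] adds [w], so [b] solves
   [2 b + w = 2 pi B]; it is positive because [a^-1 < B]. *)
pose b := (2 * pi * B - w) / 2.
have b0 : 0 < b.
  rewrite divr_gt0// subr_gt0 /w ltr_pM2l// mulr_gt0//.
pose h := cosT b (bump b).
have tb := test_bump b.
have sh : schwartz1 b h by exact: schwartz1_cosT.
have bh : band_limited b h by exact: band_limited_cosT.
pose hh x := h x * h x.
have shh : schwartz1 b hh by exact: schwartz1_mul.
have bhh : band_limited (b + b) hh by exact: band_limited_mul_cosT.
pose phi x := hh x + -1 * (hh x * cos (w * x)).
have sphi : schwartz1 b phi
  by apply: schwartz1_add => //; apply: schwartz1_scale; exact: schwartz1_mulcos.
have phiE x : phi x = h x ^+ 2 * (1 - cos (w * x)) by rewrite /phi /hh; ring.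
have phi_ge0 x : 0 <= phi x.
  by rewrite phiE mulr_ge0 ?sqr_ge0// subr_ge0 cos_le1.
exists b, phi; split; first by [].
split.
- have -> : 2 * pi * B = b + b + `|w| by rewrite gtr0_norm// /b; field.
  apply: (band_limitedD b0) => //.
  + by apply: schwartz1_scale; exact: schwartz1_mulcos.
  + by apply: band_limitedW bhh; rewrite lerDl.
  + apply: (band_limitedZ b0); first exact: schwartz1_mulcos.
    exact: (@band_limited_mulcos _ _ b0 _ w hh shh bhh).
- move=> k; rewrite phiE (_ : w * _ = 2 * pi * k%:~R); last first.
    by rewrite /w; field; rewrite gt_eqF.
  by rewrite cos_2piMz subrr mulr0.
- have cphi : continuous phi by exact: (schwartz1_continuous b0 sphi).
  have ch : continuous h by exact: (schwartz1_continuous b0 sh).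
  have h0 : 0 < h 0 := cosT_bump0_gt0 b0.
  have [e e0 he] : exists2 e : R, 0 < e & forall x, `|x| < e -> 0 < h x.
    have /cvgrPdist_lt/(_ _ h0)/nbhs_ballP[e /= e0 he] := ch 0.
    exists e => // x xe; have := he x; rewrite /ball/= sub0r normrN => /(_ xe).
    by rewrite ltr_norml; lra.
  (* Small enough for [h x1 > 0], and strictly between the zeros [0] and [a] of
     [1 - cos (w * x)]. *)
  pose x1 := Num.min (e / 2) (a / 2).
  have x10 : 0 < x1 by rewrite lt_min !divr_gt0.
  have x1e : x1 < e.
    by rewrite gt_min (_ : e / 2 < e)// ltr_pdivrMr// ltr_pMr// ltr1n.
  have x1a : x1 < a.
    by rewrite gt_min (_ : a / 2 < a) ?orbT// ltr_pdivrMr// ltr_pMr// ltr1n.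
  have phi1 : 0 < phi x1.
    rewrite phiE mulr_gt0//.
      by rewrite exprn_gt0// he// gtr0_norm.
    (* Half-angle form: [1 - cos (2 t) = 2 sin^2 t] with [t = pi x1 / a] in [(0, pi)]. *)
    have -> : w * x1 = pi * x1 / a + pi * x1 / a.
      by rewrite /w; field; rewrite gt_eqF.
    rewrite cosD -!expr2 cos2sin2.
    have : 0 < sin (pi * x1 / a).
      apply: sin_gt0_pi; rewrite divr_gt0 ?mulr_gt0//= ltr_pdivrMr//.
      by rewrite ltr_pM2l.
    by move=> s0; have := exprn_gt0 2 s0; lra.
  have [e2 e20 pe] : exists2 e : R, 0 < e &
      forall x, `|x - x1| < e -> phi x1 / 2 < phi x.
    have phi12 : 0 < phi x1 / 2 by rewrite divr_gt0.
    have /cvgrPdist_lt/(_ _ phi12)/nbhs_ballP[e' /= e'0 he'] := cphi x1.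
    exists e' => // x xe; have := he' x; rewrite /ball/= distrC => /(_ xe).
    by rewrite ltr_norml; lra.
  exists x1, (Num.min (e2 / 2) (phi x1 / 2)); split.
    by rewrite lt_min !divr_gt0.
  move=> x; rewrite le_min => /andP[xe _]; rewrite ge_min; apply/orP; right.
  apply/ltW/pe; rewrite (le_lt_trans xe)//.
  by rewrite ltr_pdivrMr// ltr_pMr// ltr1n.
Qed.

End nonnegative_band_limited.

(** * The Fourier transform in dimension one *)

Section fourier_dimension1.
Context {R : realType}.
Local Notation mu := (@lebesgue_measure R).

(** Here [lebesgue_Rn R 1] is the image under [snoc] of a Dirac mass times [mu]; Tonelli and
    evaluation at the Dirac point leave an integral over the line. *)
Lemma ge0_integral_lebesgue_Rn1 (f : R -> \bar R) :
  measurable_fun (setT : set (measurableTypeR R)) f -> (forall x, 0 <= f x)%E ->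
  (\int[lebesgue_Rn R 1]_x f ((x : 'rV[R]_1) ord0 ord0) = \int[mu]_x f x)%E.
Proof.
move=> mf f0.
have mfc : measurable_fun [set: Rn R 1] (fun x : Rn R 1 => f ((x : 'rV[R]_1) 0 0)).
  by apply: (measurableT_comp mf); exact: measurable_coord.
have E := ge0_integral_pushforward (@measurable_snoc R 0)
  (\d_((0 : 'rV[R]_0)%R : Rn R 0) \x mu)%E measurableT mfc (fun x _ => f0 _).
apply: (etrans _ (etrans E _)).
  by apply: eq_measure_integral => [|? A _ _]; first exact: measurable_snoc.
rewrite preimage_setT fubini_tonelli1/=; last 2 first.
- exact: measurableT_comp mfc (@measurable_snoc R 0).
- by [].
rewrite integral_dirac//; last first.
  apply: measurable_fun_fubini_tonelli_F; last by move=> p; exact: f0.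
  exact: measurableT_comp mfc (@measurable_snoc R 0).
rewrite diracE mem_set// mul1e; apply: eq_integral => y _.
(* Since ['I_0] is empty, [unlift] yields [None] and the only coordinate is [y]. *)
by rewrite /snoc /= mxE; case: unliftP => //= -[].
Qed.

Lemma Rintegral_lebesgue_Rn1 (f : R -> R) :
  measurable_fun (setT : set (measurableTypeR R)) f ->
  \int[lebesgue_Rn R 1]_x f ((x : 'rV[R]_1) ord0 ord0) = \int[mu]_x f x.
Proof.
move=> mf; rewrite /Rintegral integralE [in RHS]integralE; congr (fine (_ - _)%E).
- have /measurable_EFinP/measurable_funepos mp := mf.
  apply: (etrans _ (etrans (ge0_integral_lebesgue_Rn1 mp (funepos_ge0 _)) _)) => //.
  by apply: eq_integral => x _; rewrite !funeposE.
- have /measurable_EFinP/measurable_funeneg mp := mf.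
  apply: (etrans _ (etrans (ge0_integral_lebesgue_Rn1 mp (funeneg_ge0 _)) _)) => //.
  by apply: eq_integral => x _; rewrite !funenegE.
Qed.

(** Frequency [xi] in [fourier] is angular frequency [2 * pi * xi], whence the band [2 * pi * B]. *)
Lemma fourier_band_limited (b B : R) (phi : R -> R) (xi : 'rV[R]_1) :
  0 < b -> schwartz1 b phi -> band_limited (2 * pi * B) phi -> B < `|xi 0 0| ->
  fourier (fun w : 'rV[R]_1 => Complex (phi (w 0 0)) 0) xi = 0.
Proof.
move=> b0 sphi bphi Bxi; have pi0 := pi_gt0 R.
have cphi := schwartz1_continuous b0 sphi.
have p2 : 0 < 2 * pi :> R by rewrite mulr_gt0.
have Bxi' : 2 * pi * B < `|2 * pi * xi 0 0|.
  by rewrite normrM (gtr0_norm p2) ltr_pM2l.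
have [c0 _] := bphi _ Bxi'.
(* The exponent of [fourier] is negative, so the imaginary part is the sine integral of [- phi]. *)
have [_ s0] := band_limitedZ b0 (-1) sphi bphi Bxi'.
have arg (x : 'rV[R]_1) : - (2 * pi * dot x xi) = - (2 * pi * xi 0 0 * x 0 0).
  by rewrite /dot big_ord1; ring.
have mphi : measurable_fun (setT : set (measurableTypeR R)) phi.
  exact: continuous_measurable_fun.
rewrite /fourier /cintegral /=.
have -> : \int[lebesgue_Rn R 1]_x complex.Re (Complex (phi ((x : 'rV[R]_1) 0 0)) 0 *
    cis (- (2 * pi * dot x xi))) = 0.
  apply: (etrans _ c0);
    rewrite -(Rintegral_lebesgue_Rn1 (f := fun x => phi x * cos (2 * pi * xi 0 0 * x))).
    by apply: eq_Rintegral => x _; rewrite arg /= cosN mul0r subr0.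
  apply: measurable_funM => //; apply: continuous_measurable_fun => x.
  exact: is_derive1_continuous (is_derive1_cosM x _).
have -> : \int[lebesgue_Rn R 1]_x complex.Im (Complex (phi ((x : 'rV[R]_1) 0 0)) 0 *
    cis (- (2 * pi * dot x xi))) = 0.
  apply: (etrans _ s0);
    rewrite -(Rintegral_lebesgue_Rn1 (f := fun x => -1 * phi x * sin (2 * pi * xi 0 0 * x))).
    by apply: eq_Rintegral => x _; rewrite arg /= sinN mul0r addr0; ring.
  apply: measurable_funM => //; first exact: measurable_funM.
  apply: continuous_measurable_fun => x.
  exact: is_derive1_continuous (is_derive1_sinM x _).
by [].
Qed.


End fourier_dimension1.

(** * Linear statistics of order one *)

Section linear_statistics.
Context {R : realType}.
Implicit Types (c : configuration R) (f g : R -> R) (V : set R).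

Definition statistic1 f c : \bar R :=
  linear_statistic (fun x : 'rV[R]_1 => f (x 0 0)) c.

(* [linear_statistic phi (u w)] is not known to be measurable in [w]. *)
Lemma ge0_le_integral_nonmeasurable d (T : measurableType d)
    (mu : {measure set T -> \bar R}) (f g : T -> \bar R) :
  (forall x, 0 <= f x)%E -> (forall x, f x <= g x)%E ->
  (\int[mu]_x f x <= \int[mu]_x g x)%E.
Proof.
move=> f0 fg; rewrite !ge0_integralTE//; last first.
  by move=> x; rewrite (le_trans (f0 x)).
by apply: le_ereal_sup => _ [h /= hf <-]; exists h => //= x; rewrite (le_trans (hf x)).
Qed.

(** The negative part vanishes, and a 1-tuple of distinct labels is just a label. *)
Lemma statistic1E f c : (forall x, 0 <= f x) ->
  statistic1 f c =
  \esum_(j in labels c) (f (Defs.point c j))%:E.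
Proof.
move=> f0; rewrite /statistic1 /linear_statistic [X in (_ - X)%E]esum1 ?sube0; last first.
  by move=> j _; congr EFin; apply/max_idPr; rewrite oppr_le0.
rewrite (@reindex_esum R nat (1.-tuple nat) (labels c) _ (fun j => [tuple j])); last first.
  split.
  - by move=> j cj; split => //= i; rewrite (tnth_nth 0%N) (ord1 i).
  - by move=> i j _ _ /(congr1 (fun t : 1.-tuple nat => tnth t ord0)); rewrite !(tnth_nth 0%N).
  - move=> t [_ ct]; exists (tnth t ord0); first exact: ct.
    by apply: eq_from_tnth => i; rewrite (ord1 i) (tnth_nth 0%N).
apply: eq_esum => j _; congr EFin; rewrite /points mxE (tnth_nth 0%N)/=.
exact/max_idPl.
Qed.

Lemma statistic1_ge0 f c : (forall x, 0 <= f x) ->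
  (0 <= statistic1 f c)%E.
Proof. by move=> f0; rewrite statistic1E// esum_ge0// => j _; rewrite lee_fin. Qed.

Lemma statistic1_point f c j : (forall x, 0 <= f x) -> labels c j ->
  ((f (Defs.point c j))%:E <= statistic1 f c)%E.
Proof.
move=> f0 cj; rewrite statistic1E//; apply: esum_ge; exists [set j].
  by split; [exact: finite_set1|move=> _ ->].
by rewrite fsbig_set1.
Qed.

Lemma finite_number c V : bounded_set V ->
  finite_set (labels c `&` Defs.point c @^-1` V).
Proof.
move=> [M [_ MV]]; apply: sub_finite_set (locally_finite c (M + 1)) => j [cj Vj].
by split => //; apply: MV => //; rewrite ltrDl.
Qed.

Lemma numberE c V : bounded_set V ->
  Defs.number V c = (#|` fset_set (labels c `&` Defs.point c @^-1` V)%classic |)%fset%:R%:E.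
Proof. by move=> bV; rewrite /Defs.number /counting asboolT//; exact: finite_number. Qed.

Lemma bounded_itvcc (x y : R) : bounded_set `[x, y]%classic.
Proof.
exists (`|x| + `|y|); split; first exact: num_real.
move=> M xyM z; rewrite /= in_itv/= => /andP[xz zy]; rewrite ler_norml.
have := ler_norm (- x); have := ler_norm y; rewrite normrN.
by have := normr_ge0 x; have := normr_ge0 y; lra.
Qed.

Lemma number_eq0 c V : bounded_set V -> Defs.number V c = 0%E <->
  forall j, labels c j -> ~ V (Defs.point c j).
Proof.
move=> bV; rewrite numberE//; split.
  move=> [] /eqP; rewrite pnatr_eq0 cardfs_eq0 => /eqP A0 j cj Vj.
  have : (labels c `&` Defs.point c @^-1` V) j by [].
  by rewrite -(fset_setK (finite_number c bV)) A0.
move=> H; rewrite (_ : _ `&` _ = set0) ?fset_set0 ?cardfs0//.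
by apply/seteqP; split => j // [cj Vj]; exact: (H j).
Qed.

(** On a bounded set the count is a natural number, so each preimage is a countable union of
    generating events. *)
Lemma measurable_number V : measurable V -> bounded_set V ->
  measurable_fun [set: configuration_space R] (Defs.number V).
Proof.
move=> mV bV _ Y mY; rewrite setTI.
have -> : Defs.number V @^-1` Y = \bigcup_(m in [set m : nat | Y m%:R%:E])
    [set c : configuration_space R | Defs.number V c = m%:R%:E].
  apply/seteqP; split => [c Yc|c [m Ym /= cm]]; last by rewrite /= cm.
  by rewrite /= in Yc; rewrite numberE// in Yc; eexists; [exact: Yc|rewrite /= numberE].
apply: bigcup_measurable => m _; apply: sub_sigma_algebra.
by exists V, m; split.
Qed.

Definition unit_itv (x : R) : set R := `[x, x + 1]%classic.

Let cell c n := [set j | labels c j /\ Num.truncn `|Defs.point c j| = n].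

(** A point with [n <= |x| < n + 1] lies in [[n, n + 1]] or in [[-(n + 1), -n]], the unit intervals
    controlled by [ulm]. *)
Lemma count_cell_le c n : (counting (cell c n) <=
  Defs.number (unit_itv n%:R%R) c + Defs.number (unit_itv (- n.+1%:R)%R) c)%E.
Proof.
rewrite /Defs.number; apply: (le_trans _ (measureU2 (@counting nat R) _ _)) => //.
apply: le_measure; rewrite ?inE//= => j [cj] jn.
have := truncn_itv (normr_ge0 (Defs.point c j)); rewrite jn => /andP[nj jn1].
have [p0|p0] := leP 0 (Defs.point c j).
  left; split => //; rewrite /unit_itv /= in_itv/=; rewrite ger0_norm// in nj jn1.
  by rewrite nj natr1 ltW.
right; split => //; rewrite /unit_itv /= in_itv/=; rewrite ltr0_norm// in nj jn1.
by rewrite -natr1 in jn1 *; lra.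
Qed.

Lemma esum_cell_le c n f (s : R) : 0 <= s -> (forall x, 0 <= f x) ->
  (forall x, Num.truncn `|x| = n -> f x <= s) ->
  (\esum_(j in cell c n) (f (Defs.point c j))%:E <= s%:E * counting (cell c n))%E.
Proof.
move=> s0 f0 fs.
have fin : finite_set (cell c n).
  apply: sub_finite_set (locally_finite c n.+1%:R) => j [cj jn]; split => //.
  by have := truncn_itv (normr_ge0 (Defs.point c j)); rewrite jn => /andP[_ /ltW].
rewrite esum_fset//; last by move=> j _; rewrite lee_fin.
rewrite /counting asboolT// fsbig_finite//= -EFinM sumEFin lee_fin.
rewrite (@le_trans _ _ (\sum_(j <- fset_set (cell c n)) s))//.
  rewrite big_seq [leRHS]big_seq; apply: ler_sum => j.
  by rewrite in_fset_set// inE => -[_ /fs].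
by rewrite big_const_seq count_predT iter_addr_0 mulr_natr.
Qed.

(** The weights telescope when summed and dominate [K / (1 + x^2)] on the n-th cell. The right side
    is a series of counts, hence measurable along a point process. *)
Lemma statistic1_le f (K : R) c : 0 <= K -> (forall x, 0 <= f x) ->
  (forall x, f x <= K * (1 + x ^+ 2)^-1) ->
  (statistic1 f c <=
   \sum_(n <oo) (4 * K * (n.+1%:R^-1 - n.+2%:R^-1))%:E *
     (Defs.number (unit_itv n%:R%R) c + Defs.number (unit_itv (- n.+1%:R)%R) c))%E.
Proof.
move=> K0 f0 fK; rewrite statistic1E//.
have -> : labels c = \bigcup_n cell c n.
  by apply/seteqP; split => [j cj|j [n _ []]]//; exists (Num.truncn `|Defs.point c j|).
rewrite nneseries_sum_bigcup//; last 2 first.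
  by move=> i j _ _ [k [[_ <-] [_ <-]]].
  by move=> j; rewrite lee_fin.
apply: lee_nneseries => [n _ _|n _].
  by apply: esum_ge0 => j _; rewrite lee_fin.
have s0 : 0 <= 4 * K * (n.+1%:R^-1 - n.+2%:R^-1).
  rewrite mulr_ge0 ?mulr_ge0// subr_ge0 lef_pV2 ?posrE ?ltr0n// ler_nat//.
apply: (le_trans (esum_cell_le c s0 f0 (n := n) _)).
  move=> x xn; have := truncn_itv (normr_ge0 x); rewrite xn => /andP[nx _].
  rewrite (le_trans (fK x))// -[leRHS]mulrA [leRHS]mulrCA ler_wpM2l//.
  have n0 : (0 : R) <= n%:R by [].
  have nx2 : n%:R ^+ 2 <= x ^+ 2 by rewrite -(real_normK (num_real x)) lerXn2r ?nnegrE.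
  rewrite -(natr1 n.+1) -(natr1 n).
  set m : R := n%:R in n0 nx2 *.
  have -> : (m + 1)^-1 - (m + 1 + 1)^-1 = ((m + 1) * (m + 1 + 1))^-1.
    by field; apply/andP; split; apply: lt0r_neq0; lra.
  have x0 : 0 < 1 + x ^+ 2 by rewrite ltr_wpDr ?sqr_ge0.
  have m0 : 0 < (m + 1) * (m + 1 + 1) by rewrite mulr_gt0//; lra.
  (* What remains is [(m + 1) (m + 2) <= 4 (1 + x^2)], a consequence of [m^2 <= x^2]. *)
  rewrite ler_pdivlMr// mulrC ler_pdivrMr//.
  have := sqr_ge0 (m - 1); nra.
rewrite lee_wpmul2l ?lee_fin//; exact: count_cell_le.
Qed.

End linear_statistics.

(** * Means of linear statistics *)

Section point_processes.
Context d (T : measurableType d) (R : realType) (P : probability T R).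
Variable u : {RV P >-> configuration_space R}.
Implicit Types (f g : R -> R) (V : set R).

Definition mean1 f : \bar R := mean_statistic u (fun x : 'rV[R]_1 => f (x 0 0)).

Lemma mean1_ge0 f : (forall x, 0 <= f x) -> (0 <= mean1 f)%E.
Proof. by move=> f0; apply: integral_ge0 => w _; exact: statistic1_ge0. Qed.

Lemma le_mean1 f g : (forall x, 0 <= f x) -> (forall x, f x <= g x) ->
  (mean1 f <= mean1 g)%E.
Proof.
move=> f0 fg; have g0 x : 0 <= g x by rewrite (le_trans (f0 x)).
apply: ge0_le_integral_nonmeasurable => w; first exact: statistic1_ge0.
rewrite -/(statistic1 f (u w)) -/(statistic1 g (u w)) !statistic1E//.
by apply: le_esum => j _; rewrite lee_fin.
Qed.

Lemma measurable_number_process V : measurable V -> bounded_set V ->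
  measurable_fun [set: T] (fun w => Defs.number V (u w)).
Proof.
move=> mV bV; apply: (measurableT_comp (measurable_number mV bV)).
exact: measurable_funPT.
Qed.

Lemma number_ge0 V c : (0 <= Defs.number V c :> \bar R)%E.
Proof. by rewrite /Defs.number /counting; case: ifPn => _; rewrite ?lee_fin ?leey. Qed.

(** Each unit interval has mean count at most [C], so integrating [statistic1_le] term by term
    bounds the mean by [4 K * 2 C]. *)
Lemma mean1_lty f (K : R) : ulm u -> 0 <= K -> (forall x, 0 <= f x) ->
  (forall x, f x <= K * (1 + x ^+ 2)^-1) -> (mean1 f < +oo)%E.
Proof.
move=> ulm_u K0 f0 fK; have [C uC] := ulm_u 1 isT.
have mN (x : R) : measurable_fun [set: T] (fun w => Defs.number (unit_itv x) (u w)).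
  apply: measurable_number_process; first exact: measurable_itv.
  exact: bounded_itvcc.
have NC (x : R) : (\int[P]_w Defs.number (unit_itv x) (u w) <= C%:E)%E.
  exact: (uC x).
have C0 : 0 <= C.
  rewrite -lee_fin (le_trans _ (NC 0))//; apply: integral_ge0 => w _.
  exact: number_ge0.
pose s n : R := 4 * K * (n.+1%:R^-1 - n.+2%:R^-1).
have s0 n : 0 <= s n.
  by rewrite /s mulr_ge0 ?mulr_ge0// subr_ge0 lef_pV2 ?posrE ?ltr0n// ler_nat.
pose F n w := ((s n)%:E * (Defs.number (unit_itv n%:R%R) (u w) +
  Defs.number (unit_itv (- n.+1%:R)%R) (u w)))%E.
apply: (@le_lt_trans _ _ (\int[P]_w \sum_(n <oo) F n w)%E).
  apply: ge0_le_integral_nonmeasurable => w; first exact: statistic1_ge0.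
  exact: statistic1_le.
have mF n : measurable_fun [set: T] (F n).
  by apply: measurable_funeM; apply: emeasurable_funD.
have F0 n w : (0 <= F n w)%E.
  by rewrite mule_ge0 ?lee_fin// adde_ge0// number_ge0.
rewrite integral_nneseries//.
apply: (@le_lt_trans _ _ (4 * K * (2 * C))%:E); last by rewrite ltry.
apply: lime_le.
  by apply: is_cvg_nneseries => n _ _; apply: integral_ge0 => w _; exact: F0.
apply: nearW => N.
apply: (@le_trans _ _ (\sum_(0 <= n < N) (s n * (2 * C))%:E)%E).
  apply: lee_sum => n _; rewrite /F ge0_integralZl//; last first.
  - by rewrite lee_fin.
  - by move=> w _; rewrite adde_ge0// number_ge0.
  - by apply: emeasurable_funD.
  rewrite (EFinM (s n)) lee_wpmul2l ?lee_fin//.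
  rewrite ge0_integralD//; [|by move=> w _; exact: number_ge0..].
  by rewrite mulr_natl mulr2n EFinD leeD.
rewrite sumEFin lee_fin -mulr_suml ler_wpM2r ?mulr_ge0//.
rewrite -mulr_sumr ler_piMr ?mulr_ge0//.
(* The partial sums of the weights telescope to [1 - 1 / (N + 1)]. *)
under eq_bigr do rewrite -opprB.
rewrite sumrN telescope_sumr// opprB invr1 gerBl invr_ge0 ler0n.
by [].
Qed.

Lemma ae_number_eq0 f (e : R) V : measurable V -> bounded_set V ->
  0 < e -> (forall x, 0 <= f x) -> (forall x, V x -> e <= f x) ->
  mean1 f = 0%E -> {ae P, forall w, Defs.number V (u w) = 0%E}.
Proof.
move=> mV bV e0 f0 fV mf0.
pose A := [set w | Defs.number V (u w) = 0%E].
have mA : measurable A.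
  have := measurable_number_process mV bV measurableT (emeasurable_set1 0%E).
  by rewrite setTI.
have PA : P (~` A) = 0%E.
  apply/eqP; rewrite -measure_le0 -(@lee_pmul2l _ e%:E)// mule0.
  rewrite -integral_cst//; last exact: measurableC.
  rewrite -mf0 integral_mkcond.
  apply: ge0_le_integral_nonmeasurable => w; rewrite patchE; case: ifPn => //.
  - by move=> _; rewrite lee_fin ltW.
  - rewrite inE => wA.
    have [j cj Vj] : exists2 j, labels (u w) j & V (Defs.point (u w) j).
      apply: contrapT => H; apply: wA; apply/(number_eq0 _ bV) => j cj Vj.
      by apply: H; exists j.
    by apply: (le_trans _ (statistic1_point f0 cj)); rewrite lee_fin fV.
  - by move=> _; exact: statistic1_ge0.
exists (~` A); split => //; exact: measurableC.
Qed.

Lemma mean1_eq0 f : (forall x, 0 <= f x) ->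
  {ae P, forall w, forall j, labels (u w) j -> f (Defs.point (u w) j) = 0} ->
  mean1 f = 0%E.
Proof.
move=> f0 [N [mN PN0 subN]]; apply/eqP; rewrite eq_le mean1_ge0// andbT.
(* On the exceptional null set the statistic is majorized by [+oo], whose integral there is still
   zero. *)
have <- : (\int[P]_w ((cst +oo%E) \_ N) w = 0)%E.
  by rewrite -integral_mkcond integral_cst// [X in (_ * X)%E]PN0 mule0.
apply: ge0_le_integral_nonmeasurable => w; first exact: statistic1_ge0.
rewrite patchE; case: ifPn => [_|]; first by rewrite leey.
rewrite notin_setE => wN; rewrite -/(statistic1 f (u w)) statistic1E// esum1// => j cj.
by congr EFin; apply: contrapT => fj; apply: wN; apply: subN => /(_ j cj).
Qed.

End point_processes.

(** * Translation invariance of means of tent functions *)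

Section translation_invariance.
Context {R : realType}.
Implicit Types (p t e x : R).

(** A compactly supported continuous function, as the defining property of correlation measures
    requires; [phi] itself need not have compact support. *)
Definition tent p e x : R := Num.max (e - `|x - p|) 0.

Lemma tent_ge0 p e x : 0 <= tent p e x.
Proof. by rewrite le_max lexx orbT. Qed.

Lemma tent_continuous p e : continuous (tent p e).
Proof.
move=> x; apply: (@continuous_max _ _ (fun x => e - `|x - p|) (fun=> 0)).
  apply: (@continuousB _ _ _ (fun=> e) (fun y : R => `|y - p|)); first exact: cvg_cst.
  exact: (cvg_norm (cvgB (@cvg_id _ (nbhs x)) (cvg_cst p))).
exact: cvg_cst.
Qed.

Lemma tent_shift p e t x : tent (p + t) e x = tent p e (x - t).
Proof. by rewrite /tent opprD addrA addrAC. Qed.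

Lemma compact_support_tent p e : 0 < e ->
  compact (closure [set w : 'rV[R]_1 | tent p e (w 0 0) != 0]).
Proof.
move=> e0; apply: bounded_closed_compact; last exact: closed_closure.
have clK : closed [set w : 'rV[R]_1 | `|w 0 0 - p| <= e].
  apply: (@closed_comp _ _ (fun w : 'rV[R]_1 => `|w 0 0 - p|) [set x | x <= e]).
    move=> w _; exact: (cvg_norm (cvgB (@coord_continuous R 1 1 0 0 w) (cvg_cst p))).
  exact: closed_le.
have sub : closure [set w : 'rV[R]_1 | tent p e (w 0 0) != 0] `<=`
    [set w : 'rV[R]_1 | `|w 0 0 - p| <= e].
  rewrite [X in _ `<=` X](closure_id _).1//; apply: closure_subset => w /=.
  rewrite /tent; apply: contraNT; rewrite -ltNge => h.
  by apply/eqP/max_idPr; rewrite subr_le0 ltW.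
exists (`|p| + e); split; first exact: num_real.
move=> M pM w /sub /= wp.
rewrite (le_trans _ (ltW pM))//.
rewrite [leLHS]mx_normrE; apply: bigmax_le; first by rewrite addr_ge0// ltW.
move=> [i j] _ /=; rewrite !ord1 -[w 0 0](subrK p) addrC.
by rewrite (le_trans (ler_normD _ _))// lerD2l.
Qed.

Lemma mean1_tent_shift d (T : measurableType d) (P : probability T R)
    (u : {RV P >-> configuration_space R}) p t e :
  correlation_translation_invariant u -> 0 < e ->
  mean1 u (tent (p + t) e) = mean1 u (tent p e).
Proof.
move=> inv e0; have [rho [rhoE rhoT]] := inv 1 isT.
have ct q : continuous (fun w : 'rV[R]_1 => tent q e (w 0 0)).
  move=> w; apply: (@continuous_comp _ _ _ (fun w : 'rV[R]_1 => w 0 0) (tent q e)).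
    exact: coord_continuous.
  exact: tent_continuous.
have mt q : measurable_fun [set: Rn R 1]
    (fun w : Rn R 1 => (tent q e ((w : 'rV[R]_1) 0 0))%:E).
  apply/measurable_EFinP.
  apply: (@measurableT_comp _ _ _ _ _ _ (tent q e)); last exact: measurable_coord.
  by apply: continuous_measurable_fun; exact: tent_continuous.
rewrite /mean1 !rhoE//; [|exact: compact_support_tent..].
(* The shifted tent is the tent composed with translation by [-t], and invariance of [rho] says that
   this map preserves it. *)
pose tau (w : Rn R 1) : Rn R 1 := (w : 'rV[R]_1) + const_mx (- t).
have mtau : measurable_fun [set: Rn R 1] tau.
  apply: measurable_fun_Rn => i; rewrite /tau.
  under eq_fun do rewrite !mxE.
  by apply: measurable_funD; [exact: measurable_coord|exact: measurable_cst].
have t0 q (w : Rn R 1) : (0 <= (tent q e ((w : 'rV[R]_1) ord0 ord0))%:E)%E.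
  by rewrite lee_fin tent_ge0.
have E := ge0_integral_pushforward mtau rho measurableT (mt p) (fun w _ => t0 p w).
transitivity (\int[rho]_(w in tau @^-1` setT)
    ((fun w : Rn R 1 => (tent p e ((w : 'rV[R]_1) ord0 ord0))%:E) \o tau) w)%E.
  rewrite preimage_setT; apply: eq_integral => w _ /=.
  by rewrite tent_shift /tau !mxE.
rewrite -E; apply: eq_measure_integral => A mA _.
by rewrite /= /pushforward; exact: rhoT.
Qed.

End translation_invariance.

(** * From vanishing tent means to a trivial process *)

Section covering.
Context {R : realType}.

(** Two grids indexed by naturals, one on each half-line, match the countable intersections of
    almost sure events indexed by [nat]. *)
Lemma cover_grid (r x : R) : 0 < r ->
  exists n, `|x - n%:R * r| <= r \/ `|x + n%:R * r| <= r.
Proof.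
move=> r0.
have [n /andP[n1 n2]] : exists n, n%:R * r <= `|x| <= n.+1%:R * r.
  exists (Num.truncn (`|x| / r)).
  have := truncn_itv (divr_ge0 (normr_ge0 x) (ltW r0)).
  by rewrite ler_pdivlMr// ltr_pdivrMr// => /andP[-> /ltW].
exists n; rewrite -natr1 mulrDl mul1r in n2.
have [x0|x0] := leP 0 x.
  by left; rewrite ger0_norm// in n1 n2; rewrite ler_norml; lra.
by right; rewrite ltr0_norm// in n1 n2; rewrite ler_norml; lra.
Qed.

Lemma trivial_of_mean_tent_eq0 d (T : measurableType d) (P : probability T R)
    (u : {RV P >-> configuration_space R}) (e : R) : 0 < e ->
  (forall p, mean1 u (tent p e) = 0%E) -> trivial_process u.
Proof.
move=> e0 m0 V mV; have r0 : 0 < e / 2 by rewrite divr_gt0.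
(* At half the radius the tent is still at least [e / 2]. *)
have near0 q : {ae P, forall w, forall j, labels (u w) j ->
    ~ `|Defs.point (u w) j - q| <= e / 2}.
  have : {ae P, forall w, Defs.number `[q - e / 2, q + e / 2]%classic (u w) = 0%E}.
    apply: (ae_number_eq0 _ _ r0 (tent_ge0 q e) _ (m0 q)).
    - exact: measurable_itv.
    - exact: bounded_itvcc.
    - move=> x /=; rewrite in_itv/= -ler_distl => xq.
      by rewrite le_max; apply/orP; left; lra.
  apply: filterS => w /(number_eq0 _ (bounded_itvcc _ _)) h j cj.
  by rewrite ler_distl => jq; apply: (h j cj); rewrite /= in_itv.
have pos := ae_foralln (fun n => near0 (n%:R * (e / 2))).
have neg := ae_foralln (fun n => near0 (- (n%:R * (e / 2)))).
apply: (filterS2 _ _ pos neg) => w wp wn.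
(* The set [V] may be unbounded, but almost surely there is no label at all. *)
rewrite /Defs.number (_ : _ `&` _ = set0) ?measure0//.
apply/seteqP; split => // j [cj _].
have [n [h|h]] := cover_grid (Defs.point (u w) j) r0; first exact: wp cj h.
by apply: (wn n j cj); rewrite opprK.
Qed.

End covering.

Theorem theorem1p5 (R : realType)
  (d : measure_display) (T : measurableType d) (P : probability T R)
  (d' : measure_display) (T' : measurableType d') (P' : probability T' R)
  (u : {RV P >-> configuration_space R})
  (u' : {RV P' >-> configuration_space R})
  (a B : R) (a_gt0 : 0 < a) (B_gt0 : 0 < B)
  (u_nontrivial : ~ trivial_process u)
  (u_ulm : ulm u)
  (u_invariant : correlation_translation_invariant u)
  (u'_lattice : supported_on_lattice u' a)
  (u'_mimics : mimics u' u B) :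
  B <= a^-1.
Proof.
have [//|aB] := leP B a^-1; exfalso; apply: u_nontrivial.
have [b [phi [[b0 sphi phi0] [bphi phiZ [p [e [e0 pe]]]]]]] :=
  exists_nonnegative_band_limited a_gt0 aB.
have [K K0 phiK] := schwartz1_decay b0 sphi.
(* Mimicry compares only [fine] values, and [fine] sends [+oo] to [0]; finiteness excludes that case
   when the mean for [u] is recovered below. *)
have mean_u_lty : (mean1 u phi < +oo)%E.
  apply: (mean1_lty u_ulm (ltW K0) phi0) => x.
  by rewrite -[leLHS]ger0_norm.
have mean_u' : mean1 u' phi = 0%E.
  apply: mean1_eq0 => //; apply: filterS u'_lattice => w wZ j /wZ[k ->].
  exact: phiZ.
have mean_u : mean1 u phi = 0%E.
  have [_ _ same] := u'_mimics.
  pose eta (x : 'rV[R]_1) := Complex (phi (x 0 0)) 0.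
  have eta_band xi : fourier eta xi != 0 -> forall i, `|xi 0 i| <= B.
    move=> eta0 i; rewrite (ord1 i) leNgt; apply: contra eta0 => xiB.
    exact/eqP/(fourier_band_limited b0 sphi bphi).
  have [mean_fine _] := same 1%N eta isT (schwartz1_lift b0 sphi) eta_band.
  rewrite -[LHS]fineK ?ge0_fin_numE ?mean1_ge0// mean_fine.
  by rewrite -/(mean1 u' phi) mean_u'.
apply: (trivial_of_mean_tent_eq0 e0) => q.
(* The tent at [q] is moved to [p], where it lies below [phi]. *)
rewrite -(subrKC p q) mean1_tent_shift//.
apply/eqP; rewrite eq_le mean1_ge0 ?andbT; last exact: tent_ge0.
rewrite -mean_u; apply: le_mean1; first exact: tent_ge0.
move=> x; rewrite ge_max phi0 andbT.
have [xp|xp] := leP `|x - p| e.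
  by rewrite (le_trans _ (pe x xp))// gerBl.
by rewrite (le_trans _ (phi0 x))// subr_le0 ltW.
Qed.
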